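(* Let $N\ge1$ and let $\chi_N$ be the coordinate projection on functions on $V(Y)$ retaining the finite core and the vertices $(c,n)$ with $1\le c\le r$, $1\le n\le N$. Put $$s_\theta=\frac12+\frac{i\theta}{\log q},\qquad \Sigma_\theta=\mathcal S_{\mathrm{aut}}(s_\theta),\qquad\theta\in(0,\pi)\setminus\Theta_F .$$ Then $$\mathcal E_{s_\theta}^*\chi_N\mathcal E_{s_\theta}=(q+1)\Bigl[(2N+1)W+i\Sigma_\theta^*W\dot\Sigma_\theta+\frac{i}{2\sin\theta}\bigl(e^{-i(2N+1)\theta}W\Sigma_\theta-e^{i(2N+1)\theta}\Sigma_\theta^*W\bigr)\Bigr],$$ where $\dot\Sigma_\theta=\partial_\theta\Sigma_\theta$. In particular, $i\Sigma_\theta^*W\dot\Sigma_\theta$ is Hermitian. After conjugation by $W^{-1/2}$ this middle term is exactly $iS(e^{i\theta})^*\partial_\theta S(e^{i\theta})$, i.e. $W^{-1/2}\bigl(i\Sigma_\theta^*W\dot\Sigma_\theta\bigr)W^{-1/2}=iS(e^{i\theta})^*\partial_\theta S(e^{i\theta})$.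
   Context: Let $q$ be a prime power, $a=\sqrt q$, $K=\mathbb F_q(\!(t^{-1})\!)$, $\mathcal T$ the $(q+1)$-regular Bruhat–Tits tree of $\mathrm{PGL}_2(K)$, $\Gamma<\mathrm{PGL}_2(K)$ a non-uniform arithmetic lattice, and $Y=\Gamma\backslash\mathcal T$. For a quotient vertex $v$ with lift $\widetilde v$ let $\Gamma_v=\operatorname{Stab}_\Gamma(\widetilde v)$ and $\lambda(v)=|\Gamma_v|^{-1}$; $L^2(Y,\lambda)$ has norm $\|f\|^2=\sum_v|f(v)|^2\lambda(v)$. The adjacency operator is $(Af)(v)=\sum_e[\Gamma_v:\Gamma_e]f(t(e))$, the sum over representatives $e$ of $\Gamma_v$-orbits of oriented tree edges issuing from $\widetilde v$, $\Gamma_e=\operatorname{Stab}_{\Gamma_v}(e)$, $t(e)$ the terminal quotient vertex; it is bounded and self-adjoint on $L^2(Y,\lambda)$ and is also applied to arbitrary functions on $V(Y)$. $Y$ has $r$ cusps; they are cut in their homogeneous part, so that $V(Y)$ is the disjoint union of a finite core of $d\ge1$ vertices and rays of vertices $(c,n)$, $1\le c\le r$, $n\ge1$, increasing away from the core, with $(Af)(c,n)=qf(c,n-1)+f(c,n+1)$ for $n\ge2$, $(c,1)$ joined only to the core and (with index $1$) to $(c,2)$, and $\lambda(c,n)=w_c(q+1)q^{-n}$. The number $w_c>0$ is the cusp width; $W=\operatorname{diag}(w_1,\dots,w_r)$. Let $Uf=\lambda^{1/2}f$. Then $J=UAU^{-1}$ acts on $\ell^2(V(Y))=\mathbb C^d\oplus\bigoplus_{c=1}^r\ell^2(\mathbb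 N)$ as $J(u,g)=(H_Cu+Vg(1),h)$, $h(1)=ag(2)+V^*u$, $h(n)=a\{g(n-1)+g(n+1)\}$ ($n\ge2$), where $g(n)\in\mathbb C^r$; this defines the Hermitian matrix $H_C$ and the linear map $V:\mathbb C^r\to\mathbb C^d$. For $\zeta\in\mathbb C^\times$ set $x(\zeta)=a(\zeta+\zeta^{-1})$, $$F(\zeta)=H_C-x(\zeta)I_d+\frac{\zeta^{-1}}aVV^*,\qquad S(\zeta)=-I_r+\frac{\zeta^{-1}-\zeta}aV^*F(\zeta)^{-1}V ,$$ and $\Theta_F=\{\theta\in(0,\pi):\det F(e^{i\theta})=0\}$ (a finite set). Constant-term-normalized Eisenstein family: for $b\in\mathbb C^r$ and $\zeta=q^{s-1/2}$, $\mathcal E_s(b)$ is the generalized eigenfunction of $A$ with eigenvalue $q^s+q^{1-s}$ and cusp expansion $\mathcal E_s(b)(c,n)=q^{ns}b_c+q^{n(1-s)}(\mathcal S_{\mathrm{aut}}(s)b)_c$, unique when $F(\zeta)$ is invertible and $\zeta\neq\pm1$ (continued meromorphically elsewhere); this defines the $r\times r$ matrix $\mathcal S_{\mathrm{aut}}(s)$. $\mathcal E_{s}^*\chi_N\mathcal E_{s}$ is the $r\times r$ matrix with $(c,d)$ entry $\langle\chi_N\mathcal E_s(e_d),\mathcal E_s(e_c)\rangle_{L^2(Y,\lambda)}$ (a finite sum), with inner product linear in the first variable and $e_c$ the standard vectors of $\mathbb C^r$. *)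

(* Defs.v *)
From HB Require Import structures.
From mathcomp Require Import all_boot all_order all_algebra.
From mathcomp Require Import generic_quotient monoid fraction spectral.
From mathcomp Require Import complex finmap.
From mathcomp Require Import all_classical all_reals all_analysis.

Set Implicit Arguments.
Unset Strict Implicit.
Unset Printing Implicit Defensive.

Import Order.TTheory GRing.Theory Num.Theory.
Import numFieldNormedType.Exports.
Local Open Scope classical_set_scope.
Local Open Scope complex_scope.
Local Open Scope sesquilinear_scope.
Local Open Scope quotient_scope.
Local Open Scope ring_scope.

(* [f n] is the coefficient of the n-th power of the variable. *)
Definition fps (k : fieldType) : Type := nat -> k.

Section PowerSeries.
Variable k : fieldType.
Implicit Types f g h : fps k.

HB.instance Definition _ := GRing.Zmodule.copy (fps k) (nat -> k).

Definition fps_mul f g : fps k := fun n => \sum_(i < n.+1) f i * g (n - i)%N.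
Definition fps_one : fps k := fun n => (n == 0)%:R.
Definition fps_var : fps k := fun n => (n == 1)%:R.

Let trunc N f : {poly k} := \poly_(i < N) f i.

Let fps_mulE N f g n : (n < N)%N -> fps_mul f g n = (trunc N f * trunc N g)`_n.
Proof.
move=> nN; rewrite coefM; apply: eq_bigr => i _; rewrite !coef_poly.
have iN : (i < N)%N by rewrite (leq_trans (ltn_ord i)).
by rewrite iN (leq_ltn_trans (leq_subr _ _) nN).
Qed.

Fact fps_mulA : associative fps_mul.
Proof.
move=> f g h; apply/funext => n.
transitivity ((trunc n.+1 f * (trunc n.+1 g * trunc n.+1 h))`_n).
  rewrite coefM; apply: eq_bigr => i _.
  rewrite coef_poly ltn_ord (@fps_mulE n.+1) //.
  by rewrite ltnS leq_subr.
rewrite mulrA coefM; apply: eq_bigr => i _.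
by rewrite coef_poly ltnS leq_subr (@fps_mulE n.+1).
Qed.

Fact fps_mulC : commutative fps_mul.
Proof.
by move=> f g; apply/funext => n; rewrite !(@fps_mulE n.+1) // mulrC.
Qed.

Fact fps_mul1 : left_id fps_one fps_mul.
Proof.
move=> f; apply/funext => n; rewrite /fps_mul big_ord_recl big1 ?addr0 ?subn0.
  by rewrite /fps_one mul1r.
by move=> i _; rewrite /fps_one /= mul0r.
Qed.

Fact fps_mulDl : left_distributive fps_mul +%R.
Proof.
move=> f g h; apply/funext => n.
transitivity (fps_mul f h n + fps_mul g h n) => //.
by rewrite /fps_mul -big_split; apply: eq_bigr => i _; apply: mulrDl.
Qed.

Fact fps_one_neq0 : fps_one != 0.
Proof.
by apply/eqP => /(congr1 (fun f => f 0%N)) /eqP; rewrite oner_eq0.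
Qed.

HB.instance Definition _ := GRing.Zmodule_isComNzRing.Build (fps k)
  fps_mulA fps_mulC fps_mul1 fps_mulDl fps_one_neq0.

Definition fps_unit : {pred fps k} := fun f => `[< exists g, g * f = 1 >].
Definition fps_inv f : fps k := xget f [set g | g * f = 1].

Fact fps_mulV : {in fps_unit, left_inverse 1 fps_inv *%R}.
Proof. by move=> f /asboolP; rewrite /fps_inv; apply: xgetPex. Qed.

Fact fps_unitP f g : g * f = 1 -> f \in fps_unit.
Proof. by move=> gf; apply/asboolP; exists g. Qed.

Fact fps_inv_out : {in [predC fps_unit], fps_inv =1 id}.
Proof.
move=> f /asboolP nu; rewrite /fps_inv.
by case: xgetP => // g _ gf; case: nu; exists g.
Qed.

HB.instance Definition _ := GRing.ComNzRing_hasMulInverse.Build (fps k)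
  fps_mulV fps_unitP fps_inv_out.

Fact fps_integral f g : f * g = 0 -> (f == 0) || (g == 0).
Proof.
have nz h : h != 0 -> exists n, h n != 0.
  move=> h0; apply: contrapT => hn; case/eqP: h0; apply/funext => n.
  by apply/eqP; apply: contrapT => /negP ?; apply: hn; exists n.
move=> fg; apply: contrapT => /negP; rewrite negb_or => /andP[/nz ef /nz eg].
case: (ex_minnP ef) (ex_minnP eg) => m fm mP [n gn nP].
have := congr1 (fun h : fps k => h (m + n)%N) fg.
rewrite [LHS]/(fps_mul f g (m + n)) /fps_mul.
have mlt : (m < (m + n).+1)%N by rewrite ltnS leq_addr.
rewrite (bigD1 (Ordinal mlt)) //= addKn big1 ?addr0.
  by move/eqP; rewrite mulf_eq0 (negPf fm) (negPf gn).
move=> i /eqP/val_eqP /= im; case: (ltngtP i m) im => // im _.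
  have -> : f i = 0; last by rewrite mul0r.
  by apply/eqP; apply: contraTT im => /mP; rewrite -leqNgt.
have -> : g (m + n - i)%N = 0; last by rewrite mulr0.
apply/eqP; apply/negPn/negP => /nP; rewrite leqNgt => /negP; apply.
by rewrite ltn_subLR 1?addnC ?ltn_add2r // -ltnS ltn_ord.
Qed.

HB.instance Definition _ :=
  GRing.ComUnitRing_isIntegral.Build (fps k) fps_integral.

End PowerSeries.

(* k((t^-1)) is the fraction field of k[[t^-1]]. *)
Notation laurent k := {fraction (fps k)}.
Definition tinv (k : fieldType) : laurent k := FracField.tofrac (fps_var k).
Definition laurent_int (k : fieldType) : set (laurent k) :=
  range (@FracField.tofrac (fps k)).

Section GL2.
Variable K : fieldType.

Record GL2 := MkGL2 { GL2_val :> 'M[K]_2; GL2_unit : GL2_val \in unitmx }.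

HB.instance Definition _ := [isSub for GL2_val].
HB.instance Definition _ := [Choice of GL2 by <:].

Implicit Types g h l : GL2.

Definition GL2_one := MkGL2 (unitmx1 K 2).
Definition GL2_inv g := MkGL2 (etrans (unitmx_inv g) (GL2_unit g)).

Fact GL2_mul_subproof g h : g *m h \in unitmx.
Proof. by rewrite unitmx_mul !GL2_unit. Qed.
Definition GL2_mul g h := MkGL2 (GL2_mul_subproof g h).

Fact GL2_mulA : associative GL2_mul.
Proof. by move=> g h l; apply: val_inj; rewrite /= mulmxA. Qed.
Fact GL2_mul1 : left_id GL2_one GL2_mul.
Proof. by move=> g; apply: val_inj; rewrite /= mul1mx. Qed.
Fact GL2_1mul : right_id GL2_one GL2_mul.
Proof. by move=> g; apply: val_inj; rewrite /= mulmx1. Qed.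
Fact GL2_mulV : left_inverse GL2_one GL2_inv GL2_mul.
Proof. by move=> g; apply: val_inj; rewrite /= mulVmx ?GL2_unit. Qed.
Fact GL2_Vmul : right_inverse GL2_one GL2_inv GL2_mul.
Proof. by move=> g; apply: val_inj; rewrite /= mulmxV ?GL2_unit. Qed.

HB.instance Definition _ := isGroup.Build GL2
  GL2_mulA GL2_mul1 GL2_1mul GL2_mulV GL2_Vmul.

Definition proportional g h : bool :=
  `[< exists2 a : K, a != 0 & GL2_val g = a *: GL2_val h >].

Fact proportional_refl : reflexive proportional.
Proof. by move=> g; apply/asboolP; exists 1; rewrite ?oner_eq0 ?scale1r. Qed.
Fact proportional_sym : symmetric proportional.
Proof.
have imp g h : proportional g h -> proportional h g.
  move=> /asboolP[a a0 e]; apply/asboolP; exists a^-1; first by rewrite invr_eq0.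
  by rewrite e scalerA mulVf ?scale1r.
by move=> g h; apply/idP/idP; apply: imp.
Qed.
Fact proportional_trans : transitive proportional.
Proof.
move=> h g l /asboolP[a a0 ea] /asboolP[b b0 eb]; apply/asboolP.
by exists (a * b); rewrite ?mulf_neq0 // ea eb scalerA.
Qed.

Canonical proportional_equiv :=
  EquivRel proportional proportional_refl proportional_sym proportional_trans.

Definition PGL2 := {eq_quot proportional}.
HB.instance Definition _ := Choice.on PGL2.
HB.instance Definition _ := EqQuotient.on PGL2.

Implicit Types x y z : PGL2.

Definition PGL2_one : PGL2 := \pi_PGL2 1%g.
Definition PGL2_mul x y : PGL2 := \pi_PGL2 (repr x * repr y)%g.
Definition PGL2_inv x : PGL2 := \pi_PGL2 (repr x)^-1%g.

Fact piPGL2P g h :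
  reflect (exists2 a : K, a != 0 & GL2_val g = a *: GL2_val h)
          (\pi_PGL2 g == \pi_PGL2 h).
Proof. by apply: (iffP idP); rewrite eqmodE => /asboolP. Qed.

Fact repr_piPGL2 g :
  exists2 a : K, a != 0 & GL2_val (repr (\pi_PGL2 g)) = a *: GL2_val g.
Proof. by apply/piPGL2P; rewrite reprK. Qed.

Fact PGL2_mul_pi g h :
  PGL2_mul (\pi_PGL2 g) (\pi_PGL2 h) = \pi_PGL2 (g * h)%g.
Proof.
have [a a0 ea] := repr_piPGL2 g; have [b b0 eb] := repr_piPGL2 h.
apply/eqP/piPGL2P; exists (a * b); first by rewrite mulf_neq0.
by rewrite /= ea eb -scalemxAl -scalemxAr scalerA.
Qed.

Fact PGL2_mulA : associative PGL2_mul.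
Proof.
move=> x y z; rewrite -(reprK x) -(reprK y) -(reprK z).
move: (repr x) (repr y) (repr z) => g h l.
rewrite (PGL2_mul_pi h l) (PGL2_mul_pi g h) (PGL2_mul_pi g) (PGL2_mul_pi _ l).
by rewrite mulgA.
Qed.
Fact PGL2_mul1 : left_id PGL2_one PGL2_mul.
Proof. by move=> x; rewrite -(reprK x) (PGL2_mul_pi _ (repr x)) mul1g. Qed.
Fact PGL2_1mul : right_id PGL2_one PGL2_mul.
Proof. by move=> x; rewrite -(reprK x) (PGL2_mul_pi (repr x)) mulg1. Qed.
Fact PGL2_mulV : left_inverse PGL2_one PGL2_inv PGL2_mul.
Proof. by move=> x; rewrite -[X in PGL2_mul _ X]reprK PGL2_mul_pi mulVg. Qed.
Fact PGL2_Vmul : right_inverse PGL2_one PGL2_inv PGL2_mul.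
Proof. by move=> x; rewrite -[X in PGL2_mul X _]reprK PGL2_mul_pi mulgV. Qed.

HB.instance Definition _ := isGroup.Build PGL2
  PGL2_mulA PGL2_mul1 PGL2_1mul PGL2_mulV PGL2_Vmul.

Fact piPGL2M g h : (\pi_PGL2 g * \pi_PGL2 h)%g = \pi_PGL2 (g * h)%g.
Proof. exact: PGL2_mul_pi. Qed.

End GL2.

Record subgroup (G : groupType) := Subgroup {
  subgroup_pred :> {pred G};
  subgroup_closed : group_closed subgroup_pred
}.

Definition cosets (G : groupType) (A B : set G) : set (set G) :=
  [set [set (g * h)%g | h in B] | g in A].
Definition card_set (T : choiceType) (A : set T) : nat := #|` fset_set A|%fset.
Definition group_index (G : groupType) (A B : set G) : nat :=
  card_set (cosets A B).
Definition commensurable (G : groupType) (A B : set G) : Prop :=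
  finite_set (cosets A (A `&` B)) /\ finite_set (cosets B (A `&` B)).

Section Tree.
Variable k : fieldType.
Local Notation K := (laurent k).

(* The O-lattices of K^2, O = k[[t^-1]]: the images g O^2 with g in GL_2(K). *)
Definition is_lattice (L : set 'cV[K]_2) : Prop :=
  exists g : GL2 K, L = [set GL2_val g *m x |
                         x in [set x : 'cV[K]_2 | forall i, laurent_int (x i 0)]].

Record lattice := MkLattice {
  lattice_set :> set 'cV[K]_2;
  lattice_setP : `[< is_lattice lattice_set >]
}.
HB.instance Definition _ := [isSub for lattice_set].
HB.instance Definition _ := [Choice of lattice by <:].

Implicit Types L M : lattice.

Definition homothetic L M : bool :=
  `[< exists2 a : K, a != 0 & lattice_set M = [set a *: x | x in L] >].

Let image_scale1 (A : set 'cV[K]_2) : [set 1 *: x | x in A] = A.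
Proof.
by rewrite (_ : *:%R 1 = id) ?image_id //; apply/funext => x; rewrite scale1r.
Qed.

Let image_scaleM (a b : K) (A : set 'cV[K]_2) :
  [set a *: x | x in [set b *: x | x in A]] = [set (a * b) *: x | x in A].
Proof. by rewrite image_comp; congr image; apply/funext => x /=; rewrite scalerA. Qed.

Fact homothetic_refl : reflexive homothetic.
Proof. by move=> L; apply/asboolP; exists 1; rewrite ?oner_eq0 ?image_scale1. Qed.
Fact homothetic_sym : symmetric homothetic.
Proof.
have imp L M : homothetic L M -> homothetic M L.
  move=> /asboolP[a a0 e]; apply/asboolP; exists a^-1; first by rewrite invr_eq0.
  by rewrite e image_scaleM mulVf ?image_scale1.
by move=> L M; apply/idP/idP; apply: imp.
Qed.
Fact homothetic_trans : transitive homothetic.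
Proof.
move=> M L N /asboolP[a a0 ea] /asboolP[b b0 eb]; apply/asboolP.
by exists (b * a); rewrite ?mulf_neq0 // eb ea image_scaleM.
Qed.

Canonical homothetic_equiv :=
  EquivRel homothetic homothetic_refl homothetic_sym homothetic_trans.

Definition vertex := {eq_quot homothetic}.
HB.instance Definition _ := Choice.on vertex.
HB.instance Definition _ := EqQuotient.on vertex.

Definition adjacent (v w : vertex) : Prop :=
  exists L M : lattice, [/\ v = \pi_vertex L, w = \pi_vertex M,
    [set tinv k *: x | x in L] `<` M & lattice_set M `<` L].

Fact GL2_act_subproof (g : GL2 K) L :
  `[< is_lattice [set GL2_val g *m x | x in L] >].
Proof.
have /asboolP[h ->] := lattice_setP L; apply/asboolP; exists (g * h)%g.
by rewrite image_comp; congr image; apply/funext => x /=; rewrite mulmxA.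
Qed.
Definition GL2_act (g : GL2 K) L : lattice := MkLattice (GL2_act_subproof g L).

Definition act (g : PGL2 K) (v : vertex) : vertex :=
  \pi_vertex (GL2_act (repr g) (repr v)).

Fact act_pi (g : GL2 K) L :
  act (\pi_(PGL2 K) g) (\pi_vertex L) = \pi_vertex (GL2_act g L).
Proof.
have [a a0 ea] := repr_piPGL2 g.
have /eqP := reprK (\pi_vertex L).
rewrite eq_sym eqmodE => /asboolP[b b0 eb].
apply/eqP; rewrite eq_sym eqmodE; apply/asboolP; exists (a * b).
  by rewrite mulf_neq0.
rewrite /= ea eb !image_comp; congr image; apply/funext => x /=.
by rewrite -scalemxAl -scalemxAr scalerA.
Qed.

Fact act1 (v : vertex) : act 1%g v = v.
Proof.
rewrite -(reprK v) (act_pi 1%g); congr \pi; apply: val_inj => /=.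
by rewrite (_ : mulmx 1%:M = id) ?image_id //; apply/funext => x; rewrite mul1mx.
Qed.

Fact actM (g h : PGL2 K) (v : vertex) : act (g * h)%g v = act g (act h v).
Proof.
rewrite -(reprK v) -(reprK g) -(reprK h); move: (repr v) (repr g) (repr h).
move=> L x y; rewrite (piPGL2M x y) (act_pi y L) (act_pi x) (act_pi _ L); congr \pi; apply: val_inj.
by rewrite /= image_comp; congr image; apply/funext => z /=; rewrite mulmxA.
Qed.

End Tree.

Section Quotient.
Variables (k : finFieldType) (Gamma : subgroup (PGL2 (laurent k))).
Local Notation K := (laurent k).
Implicit Types v w : vertex k.

Definition same_orbit v w : bool := `[< exists2 g, g \in Gamma & act g v = w >].

Fact same_orbit_refl : reflexive same_orbit.
Proof.
move=> v; apply/asboolP; exists 1%g; last exact: act1.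
by have [] := subgroup_closed Gamma.
Qed.
Fact same_orbit_sym : symmetric same_orbit.
Proof.
have imp v w : same_orbit v w -> same_orbit w v.
  move=> /asboolP[g gG <-]; apply/asboolP; exists g^-1%g.
    exact: (group_closedV (subgroup_closed Gamma)).
  by rewrite -actM mulVg act1.
by move=> v w; apply/idP/idP; apply: imp.
Qed.
Fact same_orbit_trans : transitive same_orbit.
Proof.
move=> w v x /asboolP[g gG <-] /asboolP[h hG <-]; apply/asboolP.
exists (h * g)%g; last exact: actM.
exact: (group_closedM (subgroup_closed Gamma)).
Qed.

Canonical same_orbit_equiv :=
  EquivRel same_orbit same_orbit_refl same_orbit_sym same_orbit_trans.

(* The vertex set V(Y) of Y = Gamma \ T; [repr y] is a lift of [y]. *)
Definition quotient_vertex := {eq_quot same_orbit}.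
HB.instance Definition _ := Choice.on quotient_vertex.
HB.instance Definition _ := EqQuotient.on quotient_vertex.

Definition stab v : set (PGL2 K) := [set g | g \in Gamma /\ act g v = v].

(* An oriented edge issuing from [v] is identified with its other end [w]. *)
Definition edge_stab v w : set (PGL2 K) := [set g | stab v g /\ act g w = w].
Definition edge_orbits v : set (set (vertex k)) :=
  [set [set act g w | g in stab v] | w in [set w | adjacent v w]].

Variable R : realType.
Local Notation C := R[i].

Definition weight (y : quotient_vertex) : R := (card_set (stab (repr y)))%:R^-1.

Definition adjacency (f : quotient_vertex -> C) (y : quotient_vertex) : C :=
  let v := repr y in
  \sum_(o \in edge_orbits v)
    let w := xget v o in
    (group_index (stab v) (edge_stab v w))%:R * f (\pi_quotient_vertex w).

(* Used when f or g has finite support; the big operator is 0 otherwise. *)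
Definition inner (f g : quotient_vertex -> C) : C :=
  \sum_(y \in [set: quotient_vertex]) f y * (g y)^* * (weight y)%:C.

(* U A U^-1, where (U f)(y) = (weight y)^(1/2) f(y). *)
Definition jacobi (g : quotient_vertex -> C) (y : quotient_vertex) : C :=
  (Num.sqrt (weight y))%:C *
  adjacency (fun z => (Num.sqrt (weight z))%:C^-1 * g z) y.

End Quotient.

Section ArithmeticLattice.
Variable k : finFieldType.
Local Notation K := (laurent k).
Implicit Types (E V : {pred K}).

Definition span (S : set K) (n : nat) (e : 'I_n -> 'M[K]_2) : set 'M[K]_2 :=
  [set M | exists2 c : 'I_n -> K, forall i, S (c i) & M = \sum_i c i *: e i].

(* The polynomials over Z mapped to K are those over the prime field of K. *)
Definition map_int_poly (p : {poly int}) : {poly K} := map_poly intr p.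
Definition transcendental (x : K) : Prop :=
  forall p : {poly int}, (map_int_poly p).[x] = 0 -> map_int_poly p = 0.
Definition prime_rational (x y : K) : Prop :=
  exists p q : {poly int}, y = (map_int_poly p).[x] / (map_int_poly q).[x].

(* E is finite over F_p(x) for some transcendental x in E; E need not contain k,
   since the place induced by K may have degree > 1. *)
Definition global_function_field E : Prop :=
  divring_closed E /\
  exists x, [/\ x \in E, transcendental x &
    exists (n : nat) (e : 'I_n -> K), (forall i, e i \in E) /\
      forall y, y \in E -> exists2 c : 'I_n -> K,
        forall i, prime_rational x (c i) & y = \sum_i c i * e i].

(* K is the completion of E at the place induced by the valuation of K. *)
Definition dense_subfield E : Prop :=
  forall (z : K) (n : nat),
    exists2 y, y \in E & laurent_int ((z - y) / tinv k ^+ n).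

(* V is a valuation ring of E other than E, that is, the ring of a place of E. *)
Definition place_ring E V : Prop :=
  [/\ subring_closed V, {subset V <= E}, ~ {subset E <= V} &
      forall x, x \in E -> x \in V \/ x^-1 \in V].

(* The elements of E that are regular at all places but the one induced by K. *)
Definition regular_ring E : set K :=
  [set x | x \in E /\ forall V, place_ring E V ->
     ~ (forall y, y \in V <-> y \in E /\ laurent_int y) -> x \in V].

(* The E-span of e is an E-algebra D with D (x)_E K = M_2(K). *)
Definition matrix_form E (e : 'I_4 -> 'M[K]_2) : Prop :=
  let D := span [set` E] e in
  [/\ forall c : 'I_4 -> K, \sum_i c i *: e i = 0 -> forall i, c i = 0,
      D 1%:M & forall M N, D M -> D N -> D (M *m N)].

Definition order_in E (e : 'I_4 -> 'M[K]_2) (O : set 'M[K]_2) : Prop :=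
  [/\ O 1%:M, forall M N, O M -> O N -> O (M *m N) &
      exists (n : nat) (b : 'I_n -> 'M[K]_2),
        O = span (regular_ring E) b /\ span [set` E] b = span [set` E] e].

Definition order_units (O : set 'M[K]_2) : set (PGL2 K) :=
  [set \pi_(PGL2 K) g | g in [set g : GL2 K | O g /\ O (invmx g)]].

Variable Gamma : subgroup (PGL2 K).

(* Since E, and the E-form of M_2 inside M_2(K), are arbitrary, there is no need to
   conjugate Gamma or to apply an automorphism of K. *)
Definition arithmetic : Prop :=
  exists E e O,
    [/\ global_function_field E, dense_subfield E, matrix_form E e,
        order_in E e O & commensurable [set` Gamma] (order_units O)].

(* The tree-lattice form of being a lattice: vertex stabilizers in PGL_2(K) are
   compact open, so Gamma is discrete iff all Gamma_v are finite, and its covolume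
   is then a positive multiple of the sum of the 1/|Gamma_v|.  Likewise Gamma is
   cocompact iff Gamma \ T is finite. *)
Definition lattice_subgroup (R : realType) : Prop :=
  (forall v, finite_set (stab Gamma v)) /\
  (\esum_(y in [set: quotient_vertex Gamma]) (weight R y)%:E < +oo)%E.
Definition uniform : Prop := finite_set [set: quotient_vertex Gamma].

Definition nonuniform_arithmetic_lattice (R : realType) : Prop :=
  [/\ lattice_subgroup R, ~ uniform & arithmetic].

End ArithmeticLattice.

(* [ray c n] is the vertex (c, n), meaningful for n >= 1 only.  [adjacency_ray1]
   says that (c, 1) is joined only to the core and, with index 1, to (c, 2). *)
Record cusp_decomposition (R : realType) (k : finFieldType)
    (Gamma : subgroup (PGL2 (laurent k))) (d r : nat) := CuspDecomposition {
  core : 'I_d -> quotient_vertex Gamma;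
  ray : 'I_r -> nat -> quotient_vertex Gamma;
  width : 'I_r -> R;
  core_inj : injective core;
  ray_inj : forall c c' n n', (0 < n)%N -> (0 < n')%N ->
    ray c n = ray c' n' -> c = c' /\ n = n';
  core_ray : forall i c n, (0 < n)%N -> core i <> ray c n;
  core_ray_cover : forall y,
    (exists i, y = core i) \/ (exists c n, (0 < n)%N /\ y = ray c n);
  adjacency_ray : forall (f : quotient_vertex Gamma -> R[i]) c n, (2 <= n)%N ->
    adjacency f (ray c n) = #|k|%:R * f (ray c n.-1) + f (ray c n.+1);
  adjacency_ray1 : forall (f : quotient_vertex Gamma -> R[i]) c,
    (forall i, f (core i) = 0) -> adjacency f (ray c 1) = f (ray c 2);
  width_gt0 : forall c, 0 < width c;
  weight_ray : forall c n, (0 < n)%N ->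
    weight R (ray c n) = width c * (#|k|%:R + 1) / #|k|%:R ^+ n
}.

Section ComplexAnalysis.
Variable R : realType.
Local Notation C := R[i].

Definition cexp (z : C) : C :=
  (expR (complex.Re z))%:C * (cos (complex.Im z) +i* sin (complex.Im z)).

Definition cderivable (f : R -> C) (t : R) : Prop :=
  derivable (fun x => complex.Re (f x)) t 1 /\
  derivable (fun x => complex.Im (f x)) t 1.
Definition cderive (f : R -> C) (t : R) : C :=
  derive1 (fun x => complex.Re (f x)) t +i* derive1 (fun x => complex.Im (f x)) t.

Definition mxderivable (m n : nat) (M : R -> 'M[C]_(m, n)) (t : R) : Prop :=
  forall i j, cderivable (fun x => M x i j) t.
Definition mxderive (m n : nat) (M : R -> 'M[C]_(m, n)) (t : R) : 'M[C]_(m, n) :=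
  \matrix_(i, j) cderive (fun x => M x i j) t.

End ComplexAnalysis.

Section Scattering.
Variables (R : realType) (k : finFieldType) (Gamma : subgroup (PGL2 (laurent k))).
Variables (d r : nat) (X : cusp_decomposition R Gamma d r).
Local Notation C := R[i].
Local Notation Y := (quotient_vertex Gamma).
Local Notation q := (#|k|).

Definition indic (y : Y) : Y -> C := fun z => (z == y)%:R.

(* The blocks H_C and V of [jacobi], read off on basis vectors. *)
Definition core_matrix : 'M[C]_d :=
  \matrix_(i, j) jacobi (indic (core X j)) (core X i).
Definition core_ray_matrix : 'M[C]_(d, r) :=
  \matrix_(i, c) jacobi (indic (ray X c 1)) (core X i).
Local Notation H := core_matrix.
Local Notation V := core_ray_matrix.

Definition sqrtq : C := (Num.sqrt q%:R)%:C.
Definition spectral_param (zeta : C) : C := sqrtq * (zeta + zeta^-1).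

Definition Fmx (zeta : C) : 'M[C]_d :=
  H - (spectral_param zeta)%:M + (zeta^-1 / sqrtq) *: (V *m V^t* ).
Definition Smx (zeta : C) : 'M[C]_r :=
  - 1%:M + ((zeta^-1 - zeta) / sqrtq) *: (V^t* *m invmx (Fmx zeta) *m V).

Definition expi (t : R) : C := cexp ('i * t%:C).
Definition Theta_F : set R :=
  [set t | 0 < t < pi /\ \det (Fmx (expi t)) = 0].

Definition qpow (s : C) : C := cexp (s * (ln q%:R)%:C).

Definition eisenstein_with (s : C) (b sigma : 'cV[C]_r) (f : Y -> C) : Prop :=
  (forall y, adjacency f y = (qpow s + qpow (1 - s)) * f y) /\
  (forall c n, (0 < n)%N ->
     f (ray X c n) = qpow (n%:R * s) * b c 0 + qpow (n%:R * (1 - s)) * sigma c 0).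

(* S_aut(s) and E_s(b), meaningful when they exist uniquely: for zeta = q^(s-1/2)
   with F(zeta) invertible and zeta different from 1 and -1. *)
Definition Saut (s : C) : 'M[C]_r :=
  xget 0 [set S | forall b : 'cV[C]_r, exists f, eisenstein_with s b (S *m b) f].
Definition eisenstein (s : C) (b : 'cV[C]_r) : Y -> C :=
  xget (fun=> 0) [set f | eisenstein_with s b (Saut s *m b) f].

Definition chi (N : nat) (f : Y -> C) : Y -> C := fun y =>
  if `[< (exists i, y = core X i) \/
         (exists c n, (1 <= n <= N)%N /\ y = ray X c n) >] then f y else 0.

Definition truncated_gram (N : nat) (s : C) : 'M[C]_r :=
  \matrix_(c, c') inner (chi N (eisenstein s (delta_mx c' 0)))
                        (eisenstein s (delta_mx c 0)).

Definition width_mx : 'M[C]_r := diag_mx (\row_c (width X c)%:C).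
Definition width_mx_isqrt : 'M[C]_r :=
  diag_mx (\row_c ((Num.sqrt (width X c))^-1)%:C).

Definition s_theta (t : R) : C := 2^-1 + 'i * (t / ln q%:R)%:C.
Definition Sigma (t : R) : 'M[C]_r := Saut (s_theta t).

End Scattering.

(* Main.v *)
(* Write z = e^(i theta), a = sqrt q, F = F(z), G = F^-1.  The recurrence along the
   rays turns the eigenvalue equation with prescribed cusp expansion into
     F u = (z^-1 - z) V b,   sigma = S(z) b,
   for the core values u and the cusp coefficients b, sigma, all rescaled by the square
   root of lambda; hence Sigma_theta = W^(-1/2) S(z) W^(1/2), and the truncated Gram
   matrix is |z^-1 - z|^2 V^* G^* G V plus a geometric sum over the rays.  That J is
   Hermitian comes from counting the g in Gamma which move a lift of one vertex next to
   a lift of the other.  For kappa = (z^-1 - z)/a one has F - F^* = kappa V V^*, whence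
   S^* V^* G = - V^* G^*; this gives the unitarity of S, and it collapses i S^* dS to
   |z^-1 - z|^2 V^* G^* G V minus explicit boundary terms. *)

Require Import Defs.
From HB Require Import structures.
From mathcomp Require Import all_boot all_order all_algebra.
From mathcomp Require Import generic_quotient monoid fraction finmap.
From mathcomp Require Import spectral complex.
From mathcomp Require Import all_classical all_reals all_analysis.
From mathcomp Require Import ring.
Import Order.TTheory GRing.Theory Num.Theory.
Import numFieldNormedType.Exports.
Local Open Scope classical_set_scope.
Local Open Scope complex_scope.
Local Open Scope sesquilinear_scope.
Local Open Scope ring_scope.

Set Implicit Arguments.
Unset Strict Implicit.
Unset Printing Implicit Defensive.

(** * Cardinalities of fibres and orbits *)

(** The decomposition of Y prescribes A only at ray vertices, while J also needs the edges that
    leave the core and those from (c,1) into the core. Both are recovered from [nb_edges_sym], a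
    balance between edge counts and stabilizer orders. The factor q+1 comes from lambda(c,n) = w_c
    (q+1) q^-n. The root of this weight is sqrt(w_c (q+1)) a^-n, so the cusp coefficients are
    rescaled by D = sqrt(q+1) W^(1/2); the scalar cancels in D^-1 S D and is squared when the Gram
    matrix is multiplied by D on both sides. The sum over 1 <= n <= N yields only 2N identity
    matrices. Its lower boundary terms equal the boundary terms of i S^* dS plus one more identity,
    hence 2N+1. [Saut] and [eisenstein] are picked by [xget], so existence and determinacy must be
    known before either can be computed. This works where F is invertible, and differentiating Sigma
    therefore relies on that condition being open. *)

Section FiniteSets.
Variables T U : choiceType.
Implicit Types (A : set T).

Lemma fsbig_partition (S : nmodType) A (h : T -> U) (F : T -> S) :
  finite_set A ->
  \sum_(x \in A) F x = \sum_(u \in h @` A) \sum_(x \in A `&` [set x | h x = u]) F x.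
Proof.
move=> fA; have fh : finite_set (h @` A) by exact: finite_image.
rewrite !fsbig_finite //= (partition_big_imfset _ h) fset_set_image //.
apply: eq_bigr => u _.
have fAu : finite_set (A `&` [set x | h x = u]) by apply: finite_setIl.
rewrite fsbig_finite //= -big_filter; apply: perm_big; apply: uniq_perm.
- exact/filter_uniq/fset_uniq.
- exact: fset_uniq.
move=> x; rewrite mem_filter !in_fset_set //.
apply/andP/idP; rewrite !inE; first by move=> [/eqP hx Ax]; split.
by move=> [Ax /eqP hx].
Qed.

Lemma card_set_sum A : finite_set A -> card_set A = \sum_(x \in A) 1%N.
Proof. by move=> fA; rewrite fsbig_finite //= /card_set card_fset_sum1. Qed.

Lemma card_set_gt0 A x : finite_set A -> A x -> (0 < card_set A)%N.
Proof.
move=> fA Ax; rewrite /card_set cardfs_gt0; apply/fset0Pn; exists x.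
by rewrite in_fset_set // inE.
Qed.

Lemma card_fibers A (h : T -> U) m : finite_set A ->
  (forall u, (h @` A) u -> card_set (A `&` [set x | h x = u]) = m) ->
  card_set A = (card_set (h @` A) * m)%N.
Proof.
move=> fA hm; rewrite card_set_sum // (fsbig_partition h) //.
have fh : finite_set (h @` A) by exact: finite_image.
rewrite (eq_fsbigr (fun=> m)); last first.
  move=> u; rewrite inE => /hm <-; rewrite card_set_sum //; exact: finite_setIl.
rewrite fsbig_finite //= /card_set big_const_seq count_predT iter_addn_0 mulnC.
by [].
Qed.

End FiniteSets.

Lemma card_set_bij (T U : choiceType) (A : set T) (B : set U) (h : T -> U) :
  finite_set A -> set_bij A B h -> card_set B = card_set A.
Proof.
move=> fA [hAB inj_h hBA].
have -> : B = h @` A.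
  by apply/seteqP; split => // _ [x Ax <-]; apply: hAB.
rewrite (@card_fibers T U A h 1) ?muln1 // => _ [x Ax <-].
suff -> : A `&` [set y | h y = h x] = [set x] by rewrite /card_set fset_set1 cardfs1.
by apply/seteqP; split => [y [Ay hyx]|_ ->] //=; apply: inj_h; rewrite ?inE.
Qed.

Section OrbitStabilizer.
Variables (G : groupType) (S : choiceType).
Local Open Scope group_scope.

(* Both the cosets of a stabilizer and the orbit are quotients of A, with fibres
   the left translates of B. *)
Lemma group_index_orbit (A : set G) (act : G -> S -> S) (x : S) :
  finite_set A -> A 1 -> (forall g h, A g -> A h -> A (g * h)) ->
  (forall g, A g -> A g^-1) ->
  (forall y, act 1 y = y) -> (forall g h y, act (g * h) y = act g (act h y)) ->
  group_index A [set g | A g /\ act g x = x] = card_set [set act g x | g in A].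
Proof.
move=> fA A1 AM AV act1 actM; set B := [set g | _].
have fB : finite_set B by apply: sub_finite_set fA => g [].
have B0 : (0 < card_set B)%N by apply: (@card_set_gt0 _ _ 1).
pose coset g := [set (g * h)%g | h in B].
have fiber h : A h -> card_set [set (h * b)%g | b in B] = card_set B.
  move=> Ah; apply: card_set_bij (fun b => (h * b)%g) fB _; split.
  - by move=> b Bb; exists b.
  - by move=> b c _ _; apply: mulgI.
  - by move=> b.
apply/eqP; rewrite -(eqn_pmul2r B0); apply/eqP; rewrite /group_index.
transitivity (card_set A); [symmetry|]; apply: card_fibers => //.
  move=> _ [h Ah <-]; rewrite -(fiber h Ah); congr card_set.
  apply/seteqP; split => [g [Ag <-]|_ [b [Ab bx] <-]].
    by exists 1; rewrite ?mulg1 //; split.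
  split; first exact: AM.
  apply/seteqP; split => [_ [c [Ac cx] <-]|_ [c [Ac cx] <-]].
    by exists (b * c); rewrite ?mulgA //; split; [exact: AM|rewrite actM cx].
  exists (b^-1 * c); rewrite -?mulgA ?mulVKg //; split; first by apply: AM; auto.
  by rewrite actM cx -{1}bx -actM mulVg.
move=> _ [h Ah <-]; rewrite -(fiber h Ah); congr card_set.
apply/seteqP; split => [g [Ag gh]|_ [b [Ab bx] <-]].
  exists (h^-1 * g); rewrite ?mulVKg //; split; first by apply: AM; auto.
  by rewrite actM gh -actM mulVg act1.
by split; [exact: AM|rewrite /= actM bx].
Qed.

End OrbitStabilizer.

(** * Neighbors in the tree *)

Section Tree.
Variable k : fieldType.
Local Notation K := (laurent k).
Local Open Scope quotient_scope.
Implicit Types (L M : lattice k) (v w : vertex k).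

Definition fps_const (c : k) : fps k := fun n => if n == 0%N then c else 0.
Definition fps_shift (f : fps k) : fps k := fun n => f n.+1.

Lemma fps_decomp (f : fps k) :
  f = fps_const (f 0%N) + fps_var k * fps_shift f.
Proof.
apply/funext => n.
transitivity (fps_const (f 0%N) n + fps_mul (fps_var k) (fps_shift f) n) => //.
rewrite /fps_mul /fps_const; case: n => [|n].
  by rewrite big_ord_recl big_ord0 /fps_var /= mul0r !addr0.
rewrite big_ord_recl big_ord_recl big1 => [|i _]; last by rewrite /fps_var mul0r.
by rewrite /fps_var /fps_shift /= mul0r mul1r !add0r addr0 subn1.
Qed.

(** Here [c] is the residue of [x]; over a finite [k] it leaves finitely many classes of a lattice L
    modulo t^-1 L. *)
Lemma laurent_int_decomp (x : K) : laurent_int x ->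
  exists (c : k) (y : K),
    laurent_int y /\ x = FracField.tofrac (fps_const c) + tinv k * y.
Proof.
move=> [f _ <-]; exists (f 0%N), (FracField.tofrac (fps_shift f)).
split; first by exists (fps_shift f).
by rewrite {1}(fps_decomp f) rmorphD rmorphM.
Qed.

Lemma laurent_intB (x y : K) : laurent_int x -> laurent_int y -> laurent_int (x - y).
Proof. by move=> [f _ <-] [g _ <-]; exists (f - g); rewrite ?rmorphB. Qed.

Lemma tinv_neq0 : tinv k != 0.
Proof.
rewrite tofrac_eq0; apply/eqP => /(congr1 (fun f => f 1%N)).
by move/eqP; rewrite (_ : fps_var k 1%N = 1) ?oner_eq0.
Qed.

Lemma lattice0 L : lattice_set L 0.
Proof.
have /asboolP[g ->] := lattice_setP L; exists 0; last by rewrite mulmx0.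
by move=> i; exists 0; rewrite // mxE rmorph0.
Qed.

Lemma latticeB L x y : lattice_set L x -> lattice_set L y -> lattice_set L (x - y).
Proof.
have /asboolP[g ->] := lattice_setP L => -[a Oa <-] [b Ob <-].
exists (a - b); last by rewrite mulmxBr.
by move=> i; rewrite !mxE; apply: laurent_intB.
Qed.

Lemma latticeD L x y : lattice_set L x -> lattice_set L y -> lattice_set L (x + y).
Proof.
move=> Lx Ly; rewrite -[y]opprK; apply: latticeB => //.
by rewrite -sub0r; apply: latticeB => //; apply: lattice0.
Qed.

(** The case distinction makes scaling total, so that no proof of a <> 0 has to be carried inside
    the term. *)
Fact scale_lattice_subproof (a : K) L :
  `[< is_lattice (if a == 0 then lattice_set L else [set a *: x | x in L]) >].
Proof.
case: ifPn => [_|a0]; first exact: lattice_setP.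
have /asboolP[g ->] := lattice_setP L; apply/asboolP.
have au : (a *: GL2_val g) \in unitmx by rewrite unitmxZ ?unitfE ?GL2_unit.
exists (MkGL2 au); rewrite image_comp; congr image; apply/funext => x /=.
by rewrite scalemxAl.
Qed.
(* Scaling by [0] returns [L] itself. *)
Definition scale_lattice (a : K) L : lattice k := MkLattice (scale_lattice_subproof a L).

Lemma scale_latticeE (a : K) L : a != 0 ->
  lattice_set (scale_lattice a L) = [set a *: x | x in L].
Proof. by rewrite /= => /negPf ->. Qed.

Lemma pi_scale_lattice (a : K) L : a != 0 ->
  \pi_(vertex k) (scale_lattice a L) = \pi_(vertex k) L.
Proof.
move=> a0; apply/eqP; rewrite eq_sym eqmodE; apply/asboolP.
by exists a => //; rewrite scale_latticeE.
Qed.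

Lemma proper_image (T U : Type) (f : T -> U) (A B : set T) :
  injective f -> A `<` B -> f @` A `<` f @` B.
Proof.
move=> f_inj [AB BA]; split; first exact: image_subset.
move=> sBA; apply: BA => x Bx.
have [|y Ay /f_inj <-] := sBA (f x); last exact: Ay.
by exists x.
Qed.

Lemma scale_inj (a : K) : a != 0 -> injective (fun x : 'cV[K]_2 => a *: x).
Proof. by move=> a0 x y /(congr1 ( *:%R a^-1)); rewrite !scalerA mulVf // !scale1r. Qed.

Lemma image_scaleC (a b : K) (A : set 'cV[K]_2) :
  [set a *: x | x in [set b *: x | x in A]] = [set b *: x | x in [set a *: x | x in A]].
Proof.
by rewrite !image_comp; congr image; apply/funext => x /=; rewrite !scalerA mulrC.
Qed.

(** From t^-1 L < M < L follows t^-1 M < t^-1 L < M, and t^-1 L is homothetic to L. *)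
Lemma adjacent_sym v w : Defs.adjacent v w -> Defs.adjacent w v.
Proof.
have t0 := tinv_neq0.
move=> [L [M [-> -> tLM ML]]]; exists M, (scale_lattice (tinv k) L).
rewrite pi_scale_lattice // scale_latticeE //; split => //.
exact: (proper_image (scale_inj t0)).
Qed.

Lemma adjacent_act (g : PGL2 K) v w :
  Defs.adjacent v w -> Defs.adjacent (act g v) (act g w).
Proof.
move=> [L [M [-> -> tLM ML]]]; rewrite -(reprK g); set h := repr g.
have h_inj : injective (fun x : 'cV[K]_2 => GL2_val h *m x).
  by move=> x y /(congr1 (mulmx (invmx h))); rewrite !mulKmx ?GL2_unit.
rewrite (act_pi h L) (act_pi h M); exists (GL2_act h L), (GL2_act h M); split => //=.
  rewrite (_ : [set tinv k *: x | x in _] =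
      [set GL2_val h *m x | x in [set tinv k *: x | x in L]]).
    exact: (proper_image h_inj).
  by rewrite !image_comp; congr image; apply/funext => x /=; rewrite scalemxAr.
exact: (proper_image h_inj).
Qed.

(** Rescaling the chain of lattices moves its top to the chosen representative of [v]; all neighbors
    are then seen between t^-1 L and L for one fixed L. *)
Lemma adjacent_repr v w : Defs.adjacent v w -> exists M : lattice k,
  [/\ w = \pi_(vertex k) M, [set tinv k *: x | x in repr v] `<` M
    & lattice_set M `<` repr v].
Proof.
move=> [L [M [vL -> tLM ML]]].
have : \pi_(vertex k) L == \pi_(vertex k) (repr v) by rewrite reprK vL.
rewrite eqmodE => /asboolP[a a0 ->]; exists (scale_lattice a M).
rewrite pi_scale_lattice // scale_latticeE // image_scaleC.
by split => //; apply: (proper_image (scale_inj a0)).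
Qed.

End Tree.

(* A lattice between [t^-1 L] and [L] is determined by the residue classes in
   [L / t^-1 L = k^2] that it contains. *)
Lemma finite_neighbors (k : finFieldType) (v : vertex k) :
  finite_set [set w | Defs.adjacent v w].
Proof.
pose lats := [set M : lattice k | [set tinv k *: x | x in repr v] `<` M
  /\ lattice_set M `<` repr v].
suff fl : finite_set lats.
  apply: sub_finite_set (finite_image (\pi_(vertex k)%qT) fl) => w.
  by move=> /adjacent_repr[M [-> ? ?]]; exists M.
have /asboolP[g gE] := lattice_setP (repr v).
pose ev (c : 'cV[k]_2) : 'cV[laurent k]_2 :=
  GL2_val g *m \col_i FracField.tofrac (fps_const (c i 0)).
pose Phi (M : lattice k) := [set c : 'cV[k]_2 | `[< lattice_set M (ev c) >]]%SET.
(* Each [x] in [M1] is [ev c] plus a vector of t^-1 L. The latter lies in both lattices, so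
   membership of [x] depends on the residue vector [c] alone. *)
have sub M1 M2 : lats M1 -> lats M2 -> Phi M1 = Phi M2 ->
    lattice_set M1 `<=` lattice_set M2.
  move=> [[tM1 _] [M1v _]] [[tM2 _] _] eqPhi x M1x.
  have := M1v _ M1x; rewrite gE => -[y Oy xE].
  have cy i : exists p : k * laurent k, laurent_int p.2 /\
      y i 0 = FracField.tofrac (fps_const p.1) + tinv k * p.2.
    by have [c [z [Oz yE]]] := laurent_int_decomp (Oy i); exists (c, z).
  have [p pP] := choice cy.
  pose c : 'cV[k]_2 := \col_i (p i).1.
  pose z : 'cV[laurent k]_2 := \col_i (p i).2.
  have tz : [set tinv k *: x | x in repr v] (tinv k *: (GL2_val g *m z)).
    exists (GL2_val g *m z) => //; rewrite gE; exists z => // i.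
    by rewrite mxE; have [] := pP i.
  have xD : x = ev c + tinv k *: (GL2_val g *m z).
    rewrite -xE /ev scalemxAr -mulmxDr; congr mulmx; apply/matrixP => i j.
    by rewrite !mxE ord1; have [] := pP i.
  have : c \in Phi M1.
    rewrite inE; apply/asboolP.
    by rewrite -[ev c](addrK (tinv k *: (GL2_val g *m z))) -xD; apply: latticeB; auto.
  by rewrite eqPhi inE => /asboolP M2c; rewrite xD; apply: latticeD; auto.
have inj : {in lats &, injective Phi}.
  move=> M1 M2; rewrite !inE => l1 l2 e; apply: val_inj => /=.
  by apply/seteqP; split; apply: sub.
by rewrite -(eq_finite_set (inj_card_eq inj)); apply: finite_finset.
Qed.

(** * The adjacency operator on the quotient *)

Section Adjacency.
Variables (k : finFieldType) (Gamma : subgroup (PGL2 (laurent k))) (R : realType).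
Hypothesis stab_fin : forall v, finite_set (stab Gamma v).
Local Open Scope quotient_scope.
Local Notation Y := (quotient_vertex Gamma).
Local Notation C := R[i].
Implicit Types (y z : Y) (v w : vertex k) (f : Y -> C).

Let Gamma1 : (1 : PGL2 _)%g \in Gamma.
Proof. by have [] := subgroup_closed Gamma. Qed.

Let GammaM g h : g \in Gamma -> h \in Gamma -> (g * h)%g \in Gamma.
Proof. exact: (group_closedM (subgroup_closed Gamma)). Qed.

Let GammaV g : g \in Gamma -> g^-1%g \in Gamma.
Proof. exact: (group_closedV (subgroup_closed Gamma)). Qed.

Lemma stabM v g h : stab Gamma v g -> stab Gamma v h -> stab Gamma v (g * h)%g.
Proof. by move=> [gG gv] [hG hv]; split; [exact: GammaM | rewrite actM hv]. Qed.

Lemma stabV v g : stab Gamma v g -> stab Gamma v g^-1%g.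
Proof.
by move=> [gG gv]; split; [exact: GammaV | rewrite -{1}gv -actM mulVg act1].
Qed.

Lemma stab1 v : stab Gamma v 1%g.
Proof. by split; rewrite ?act1. Qed.

Lemma card_stab_gt0 v : (0 < card_set (stab Gamma v))%N.
Proof. by apply: (@card_set_gt0 _ _ 1%g) => //; apply: stab1. Qed.

Lemma pi_act g w : g \in Gamma -> \pi_Y (act g w) = \pi_Y w.
Proof.
by move=> gG; apply/eqP; rewrite eq_sym eqmodE; apply/asboolP; exists g.
Qed.

Lemma pi_quotientP w z : \pi_Y w = z -> exists2 g, g \in Gamma & act g (repr z) = w.
Proof.
move=> <-; have : \pi_Y (repr (\pi_Y w)) == \pi_Y w by rewrite reprK.
by rewrite eqmodE => /asboolP.
Qed.

(** By [group_index_orbit] the index [Gamma_v : Gamma_e] is the size of the orbit of the edge, on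
    which [f] is constant; the sum over orbits unfolds to the tree. *)
Lemma adjacency_neighbors f y :
  adjacency f y = \sum_(w \in [set w | Defs.adjacent (repr y) w]) f (\pi_Y w).
Proof.
pose orb w := [set act g w | g in stab Gamma (repr y)].
rewrite (fsbig_partition orb); last exact: finite_neighbors.
rewrite /adjacency /edge_orbits; apply: eq_fsbigr => _ /[!inE] -[w0 vw0 <-].
set v := repr y; set o := [set act g w0 | g in _]; set w := xget _ _.
(* The default [v] of [xget] is never reached, because [o] contains [w0]. *)
have ow : o w by apply: (@xgetPex _ v o); exists w0, 1%g; rewrite ?act1 //; apply: stab1.
have orbitE w' : o w' -> [set act g w' | g in stab Gamma v] = o.
  move=> [g gv <-]; apply/seteqP; split => [_ [h hv <-]|_ [h hv <-]].
    by exists (h * g)%g; rewrite ?actM //; apply: stabM.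
  exists (h * g^-1)%g; first by apply: stabM => //; apply: stabV.
  by rewrite -actM -mulgA mulVg mulg1.
have -> : [set w' | Defs.adjacent v w'] `&`
    [set w' | [set act g w' | g in stab Gamma v] = o] = o.
  apply/seteqP; split => [w' [_ <-]|w' ow'].
    by exists 1%g; rewrite ?act1 //; apply: stab1.
  split; last exact: orbitE.
  move: ow' => [g [gG gv] <-]; rewrite /= -gv; exact: adjacent_act.
rewrite (eq_fsbigr (fun=> f (\pi_Y w))); last first.
  by move=> w'; rewrite inE -(orbitE w ow) => -[g [gG _] <-]; rewrite pi_act.
have fo : finite_set o by apply: finite_image.
rewrite /edge_stab group_index_orbit //; last 5 first.
- exact: stab1.
- exact: stabM.
- exact: stabV.
- exact: act1.
- exact: actM.
rewrite (orbitE w ow) fsbig_finite //= big_const_seq count_predT iter_addr_0.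
by rewrite mulr_natl.
Qed.

(** Edges are counted in the tree, from one fixed lift of [y], so this is the matrix entry of A at
    (y, z); it is not symmetric in general. *)
Definition nb_edges y z : nat :=
  card_set [set w | Defs.adjacent (repr y) w /\ \pi_Y w = z].

Let fin_edges y z : finite_set [set w | Defs.adjacent (repr y) w /\ \pi_Y w = z].
Proof. by apply: sub_finite_set (finite_neighbors (repr y)) => w []. Qed.

Lemma adjacency_sum f y :
  adjacency f y = \sum_(z \in [set: Y]) (nb_edges y z)%:R * f z.
Proof.
rewrite adjacency_neighbors (fsbig_partition (fun w => \pi_Y w)); last first.
  exact: finite_neighbors.
pose P := [set \pi_Y w | w in [set w | Defs.adjacent (repr y) w]].
transitivity (\sum_(z \in P) (nb_edges y z)%:R * f z).
  apply: eq_fsbigr => z _.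
  rewrite (eq_fsbigr (fun=> f z)); last by move=> w; rewrite inE => -[_ ->].
  rewrite fsbig_finite; last exact: fin_edges.
  by rewrite big_const_seq count_predT iter_addr_0 mulr_natl.
apply: fsbig_widen => // z [_ /= Pz]; rewrite /nb_edges.
rewrite (_ : [set w | _] = set0); first by rewrite /card_set fset_set0 cardfs0 mul0r.
by apply/seteqP; split => // w [vw wz]; apply: Pz; exists w.
Qed.

Lemma adjacency_indic y z : adjacency (Defs.indic R z) y = (nb_edges y z)%:R :> C.
Proof.
rewrite adjacency_sum -(fsbig_widen [set z]) => //.
  by rewrite fsbig_set1 /Defs.indic eqxx mulr1.
by move=> z' [_ /= /eqP/negPf zz']; rewrite /Defs.indic zz' mulr0.
Qed.

(* Both sides count the [g] in [Gamma] moving the lift of [z] next to that of [y]. *)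
Lemma nb_edges_sym y z :
  (nb_edges y z * card_set (stab Gamma (repr z)) =
   nb_edges z y * card_set (stab Gamma (repr y)))%N.
Proof.
pose E y z := [set g | g \in Gamma /\ Defs.adjacent (repr y) (act g (repr z))].
have imE y' z' : [set act g (repr z') | g in E y' z'] =
    [set w | Defs.adjacent (repr y') w /\ \pi_Y w = z'].
  apply/seteqP; split => [_ [g [gG yg] <-]|w [yw wz]].
    by split; rewrite ?pi_act // reprK.
  by have [g gG gw] := pi_quotientP wz; exists g => //; split; rewrite ?gw.
have fiber y' z' g : E y' z' g ->
    E y' z' `&` [set h | act h (repr z') = act g (repr z')] =
    [set (g * h)%g | h in stab Gamma (repr z')].
  move=> [gG yg]; apply/seteqP; split => [h [[hG yh] hg]|_ [h [hG hz] <-]].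
    exists (g^-1 * h)%g; last by rewrite mulVKg.
    by split; [apply: GammaM => //; apply: GammaV | rewrite actM hg -actM mulVg act1].
  by split; [split; [exact: GammaM|] |]; rewrite /= actM hz.
(* There are finitely many neighbors, and over each of them a translate of a finite stabilizer. *)
have finE y' z' : finite_set (E y' z').
  have -> : E y' z' = \bigcup_(w in [set act g (repr z') | g in E y' z'])
      (E y' z' `&` [set h | act h (repr z') = w]).
    apply/seteqP; split => [g Eg|g [_ _ []] //].
    by exists (act g (repr z')) => //; exists g.
  apply: bigcup_finite; first by rewrite imE.
  by move=> _ [g Eg <-]; rewrite fiber //; apply: finite_image.
have cardE y' z' : card_set (E y' z') =
    (nb_edges y' z' * card_set (stab Gamma (repr z')))%N.
  rewrite /nb_edges -imE; apply: card_fibers => // _ [g Eg <-]; rewrite fiber //.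
  apply: card_set_bij (fun h => (g * h)%g) (stab_fin _) _; split.
  - by move=> h hz; exists h.
  - by move=> h h' _ _; exact: mulgI.
  - by [].
(* Inversion matches the two counts, since adjacency is symmetric and invariant under Gamma. *)
have invE y' z' g : E y' z' g -> E z' y' g^-1%g.
  move=> [gG yg]; split; first exact: GammaV.
  by apply: adjacent_sym; have := adjacent_act g^-1%g yg; rewrite -actM mulVg act1.
rewrite -!cardE; apply: card_set_bij (fun g => g^-1%g) (finE _ _) _; split.
- by move=> g /invE.
- by move=> g h _ _; exact: invg_inj.
- by move=> g /invE Eg; exists g^-1%g; rewrite ?invgK.
Qed.

(** Stabilizers have positive order, so [nb_edges_sym] transfers vanishing. This carries information
    from the rays, where A is prescribed, back to the core. *)
Lemma nb_edges_eq0 y z : nb_edges y z = 0%N -> nb_edges z y = 0%N.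
Proof.
move=> yz; have := nb_edges_sym y z; rewrite yz mul0n => /esym/eqP.
by rewrite muln_eq0 => /orP[/eqP //|]; rewrite eqn0Ngt card_stab_gt0.
Qed.

End Adjacency.

Lemma fsbig_fintype (T : finType) (I : choiceType) (S : nmodType) (h : T -> I)
    (F : I -> S) :
  injective h -> (forall i, (forall t, i <> h t) -> F i = 0) ->
  \sum_(i \in [set: I]) F i = \sum_t F (h t).
Proof.
move=> h_inj F0; rewrite (@fsbigE _ _ _ _ _ (map h (enum T))) //.
- rewrite (eq_bigl xpredT) => [|i]; last exact: mem_set.
  by rewrite big_map big_enum.
- by rewrite map_inj_uniq ?enum_uniq.
- move=> i _ /negP iT; apply: F0 => t it; apply: iT; apply/mapP; exists t => //.
  by rewrite mem_enum.
Qed.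

(** * Algebra of the scattering matrix on the unit circle *)

Lemma mulmx_deltaE (T : pzRingType) m n (A : 'M[T]_(m, n)) i j :
  (A *m (delta_mx j 0 : 'cV_n)) i 0 = A i j.
Proof. by rewrite -colE mxE. Qed.

Section ConjTranspose.
Variable C : numClosedFieldType.

Lemma adjmxE m n (A : 'M[C]_(m, n)) i j : (A^t*) i j = (A j i)^*.
Proof. by rewrite !mxE. Qed.

Lemma adjmxM m n p (A : 'M[C]_(m, n)) (B : 'M[C]_(n, p)) :
  (A *m B)^t* = B^t* *m A^t*.
Proof. by rewrite trmx_mul map_mxM. Qed.

Lemma adjmxD m n (A B : 'M[C]_(m, n)) : (A + B)^t* = A^t* + B^t*.
Proof. by rewrite linearD map_mxD. Qed.

Lemma adjmxN m n (A : 'M[C]_(m, n)) : (- A)^t* = - A^t*.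
Proof. by rewrite linearN map_mxN. Qed.

Lemma adjmxZ m n c (A : 'M[C]_(m, n)) : (c *: A)^t* = c^* *: A^t*.
Proof. by rewrite linearZ map_mxZ. Qed.

Lemma adjmx1 n : (1%:M : 'M[C]_n)^t* = 1%:M.
Proof. by rewrite trmx1 map_mx1. Qed.

Lemma adjmx_scalar n (c : C) : (c%:M : 'M[C]_n)^t* = (c^*)%:M.
Proof. by rewrite -scalemx1 adjmxZ adjmx1 scalemx1. Qed.

End ConjTranspose.

Section ScatteringAlgebra.
Variables (C : numClosedFieldType) (d r : nat) (a z : C).
Variables (H : 'M[C]_d) (V : 'M[C]_(d, r)).
Hypotheses (a0 : a != 0) (aR : a^* = a) (z0 : z != 0) (zJ : z^* = z^-1).
Hypothesis (HJ : H^t* = H).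

Let F := H - (a * (z + z^-1))%:M + (z^-1 / a) *: (V *m V^t*).
Hypothesis Fu : F \in unitmx.

Let G := invmx F.
Let kap := (z^-1 - z) / a.
Let B := V^t* *m G *m V.
Let S := - 1%:M + kap *: B.

Lemma kapJ : kap^* = - kap.
Proof. by rewrite /kap rmorphM rmorphB !fmorphV /= zJ invrK aR -mulNr opprB. Qed.

(** On the unit circle z + z^-1 is real, so only the last summand of F fails to be self-adjoint. *)
Lemma adj_Fmx : F - F^t* = kap *: (V *m V^t*).
Proof.
have xJ : (a * (z + z^-1))^* = a * (z + z^-1).
  by rewrite rmorphM rmorphD fmorphV /= zJ invrK aR addrC.
have zaJ : (z^-1 / a)^* = z / a by rewrite rmorphM !fmorphV /= zJ invrK aR.
rewrite /F !(adjmxD, adjmxN, adjmxZ, adjmx_scalar) HJ adjmxM trmxCK xJ zaJ /kap.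
by apply/matrixP => i j; rewrite !mxE; move: (\sum_j _) => s; ring.
Qed.

(** A resolvent identity: the left side is G^* (F - F^* ) G. *)
Lemma adj_invFmx : G^t* - G = kap *: (G^t* *m (V *m V^t*) *m G).
Proof.
rewrite scalemxAl scalemxAr -adj_Fmx mulmxBr mulmxBl -mulmxA mulmxV // mulmx1.
by rewrite -adjmxM mulmxV // adjmx1 mul1mx.
Qed.

Lemma adjB : B^t* = V^t* *m G^t* *m V.
Proof. by rewrite /B !adjmxM trmxCK mulmxA. Qed.

Lemma adjB_sub : B^t* - B = kap *: (B^t* *m B).
Proof.
rewrite adjB /B -mulmxBl -mulmxBr adj_invFmx -scalemxAr -scalemxAl.
by rewrite !mulmxA.
Qed.

Lemma adjS : S^t* = - 1%:M - kap *: B^t*.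
Proof. by rewrite /S adjmxD adjmxN adjmx1 adjmxZ kapJ scaleNr. Qed.

Lemma adjS_VG : S^t* *m (V^t* *m G) = - (V^t* *m G^t*).
Proof.
rewrite adjS mulmxBl mulNmx mul1mx -scalemxAl.
have -> : kap *: (B^t* *m (V^t* *m G)) = V^t* *m G^t* - V^t* *m G.
  by rewrite -mulmxBr adj_invFmx -scalemxAr adjB !mulmxA.
by rewrite opprB addKr.
Qed.

Lemma adjS_B : S^t* *m B = - B^t*.
Proof. by rewrite mulmxA adjS_VG mulNmx adjB. Qed.

(** Expanding only the right factor gives -S^* + kap S^* B. By [adjS_B] this is -S^* - kap B^*, and
    [adjS] identifies it with the identity. *)
Lemma Smx_unitary : S^t* *m S = 1%:M.
Proof.
rewrite {2}/S mulmxDr mulmxN mulmx1 -scalemxAr adjS_B adjS scalerN.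
by rewrite opprD !opprK addrK.
Qed.

(* [dF], [dS] are the derivatives in theta at z = e^(i theta), where dz = i z. *)
Let dF := - (a * ('i * z - 'i * z^-1))%:M + (- 'i * z^-1 / a) *: (V *m V^t*).
Let dS := ((- 'i * z^-1 - 'i * z) / a) *: B + kap *: (V^t* *m (- (G *m dF *m G)) *m V).
(** The columns of (z^-1 - z) G V are the core parts of the Eisenstein vectors, so P is the core
    contribution to the Gram matrix up to the factor |z^-1 - z|^2, which equals -(z^-1 - z)^2 on the
    circle. *)
Let P := (G *m V)^t* *m (G *m V).

(** By [adjS_VG] the factor S^* is absorbed into the adjacent V^* G, and [adjB_sub] replaces the
    quadratic term B^* B by the linear B^* - B. *)
Lemma adjS_dS : 'i *: (S^t* *m dS) =
  - (z^-1 - z) ^+ 2 *: P - a^-1 *: (z *: B^t* + z^-1 *: B).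
Proof.
have SdG : S^t* *m (V^t* *m (- (G *m dF *m G)) *m V) =
    - (a * ('i * z - 'i * z^-1)) *: P + (- 'i * z^-1 / a) *: (B^t* *m B).
  transitivity (V^t* *m G^t* *m dF *m (G *m V)).
    by rewrite mulmxN mulNmx mulmxN !mulmxA -(mulmxA (S^t* )) adjS_VG !mulNmx opprK.
  rewrite /dF mulmxDr mulmxN mul_mx_scalar mulmxDl mulNmx -!scalemxAl scaleNr.
  rewrite -scalemxAr -scalemxAl adjB /B /P adjmxM !mulmxA.
  by congr (- (_ *: _) + _ *: _).
have iN1 : 'i * 'i = -1 :> C by rewrite -expr2 sqrCi.
rewrite /dS mulmxDr -!scalemxAr adjS_B SdG [kap *: (_ + _)]scalerDr.
rewrite (scalerA kap (- 'i * z^-1 / a)).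
rewrite (mulrC kap) -(scalerA _ kap) -adjB_sub /kap.
move: (P) (B) (B^t* ) => p_ b_ b'_; apply/matrixP => i j; rewrite !mxE.
move: (p_ i j) (b_ i j) (b'_ i j) => p b b'.
apply/eqP; rewrite -subr_eq0; apply/eqP.
(* To [field] the element 'i is only a symbol, so the difference of the two sides is displayed as an
   explicit multiple of i^2 + 1. *)
transitivity (('i * 'i + 1) * ((z^-1 + z) / a * b' - (z^-1 - z) * (z - z^-1) * p
  - z^-1 / a * (b' - b))); last by rewrite iN1 addNr mul0r.
by field; rewrite z0 a0.
Qed.

(** Read off from the closed form [adjS_dS]: P is self-adjoint with a real coefficient, and the
    adjoint exchanges z B^* and z^-1 B. *)
Lemma adjS_dS_herm : ('i *: (S^t* *m dS))^t* = 'i *: (S^t* *m dS).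
Proof.
have PJ : P^t* = P by rewrite /P adjmxM trmxCK.
have dzJ : (- (z^-1 - z) ^+ 2)^* = - (z^-1 - z) ^+ 2.
  by rewrite rmorphN rmorphXn rmorphB fmorphV /= zJ invrK -sqrrN opprB.
rewrite adjS_dS adjmxD adjmxN !adjmxZ adjmxD !adjmxZ trmxCK PJ dzJ.
by rewrite !fmorphV /= aR zJ invrK [X in _ - _ *: X]addrC.
Qed.

Let delta := z^-1 - z.
Hypothesis delta0 : delta != 0.

(** This is z delta <> 0 in the shape of the side condition left by [field]. *)
Let zz_neq1 : 1 + - z * z != 0.
Proof.
apply: contraNneq delta0 => h.
by rewrite -(mulfK z0 delta) /delta mulrBl mulVf // -mulNr h mul0r.
Qed.

(** Unitarity of S reduces the summand at level n = i + 1 to 2 + z^(-2n) S + z^(2n) S^*; both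
    geometric series have a closed form with denominator delta. *)
Lemma cusp_gram N :
  \sum_(i < N) (z ^+ i.+1 *: 1%:M + z ^- i.+1 *: S)^t* *m
                (z ^+ i.+1 *: 1%:M + z ^- i.+1 *: S) =
  (2 * N)%:R *: 1%:M + delta^-1 *:
    ((z ^- (2 * N).+1 - z^-1) *: S - (z ^+ (2 * N).+1 - z) *: S^t*).
Proof.
elim: N => [|N IHN].
  by rewrite big_ord0 muln0 scale0r !expr1 !subrr !scale0r subr0 scaler0 addr0.
rewrite big_ord_recr {}IHN /=.
have zX n : (z ^+ n)^* = z ^- n by rewrite rmorphXn /= zJ exprVn.
have zVX n : (z ^- n)^* = z ^+ n by rewrite fmorphV /= zX invrK.
have GJ n : (z ^+ n *: 1%:M + z ^- n *: S)^t* = z ^- n *: 1%:M + z ^+ n *: S^t*.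
  by rewrite (adjmxD (z ^+ n *: _)) (adjmxZ _ 1%:M) (adjmxZ _ S) adjmx1 zX zVX.
rewrite GJ mulmxDl !mulmxDr -!scalemxAl -!scalemxAr.
rewrite !mul1mx mulmx1 Smx_unitary.
rewrite (mulnS 2) !addSn add0n.
move: (S) (S^t* ) => s s'; apply/matrixP => i j; rewrite !mxE.
move: (s i j) (s' i j) (i == j) => {}s {}s' e.
have zN : z ^+ N != 0 by rewrite expf_neq0.
have e2 : z ^+ (2 * N) = z ^+ N * z ^+ N by rewrite mulnC exprM expr2.
move: (2 * N)%N e2 => M e2; rewrite !exprS e2 -(addn2 M) natrD /delta.
by field; rewrite zN z0 zz_neq1.
Qed.

(** The lower ends of the geometric sums satisfy -(z^-1 S - z S^* ) / delta = 1 - (z B^* + z^-1 B) /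
    a. The last part is the boundary term of [adjS_dS], and the 1 turns 2N into 2N + 1. *)
Lemma truncated_gram_formula N :
  (delta *: (G *m V))^t* *m (delta *: (G *m V)) +
  \sum_(i < N) (z ^+ i.+1 *: 1%:M + z ^- i.+1 *: S)^t* *m
                (z ^+ i.+1 *: 1%:M + z ^- i.+1 *: S) =
  (2 * N + 1)%:R *: 1%:M + 'i *: (S^t* *m dS) +
    delta^-1 *: (z ^- (2 * N + 1) *: S - z ^+ (2 * N + 1) *: S^t*).
Proof.
have dJ : delta^* = - delta by rewrite rmorphB fmorphV /= zJ invrK opprB.
rewrite cusp_gram adjmxZ dJ -scalemxAl -scalemxAr adjS_dS adjS addn1 /S /kap.
rewrite -natr1 -/delta -/P.
rewrite /delta; move: (P) (B) (B^t* ) => p b b'.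
apply/matrixP => i j; rewrite !mxE; move: (p i j) (b i j) (b' i j) => {}p {}b {}b'.
have zN : z ^+ (2 * N).+1 != 0 by rewrite expf_neq0.
move: (z ^+ (2 * N).+1) zN => Z Z0.
by field; rewrite Z0 z0 a0 zz_neq1.
Qed.

End ScatteringAlgebra.

(** * Complex-valued and matrix-valued derivatives *)

Section ComplexDerivative.
Variable R : realType.
Local Notation C := R[i].
Implicit Types (f g : R -> C) (t : R) (l m c : C).

(** Differentiability and value travel together here, whereas [cderive] alone returns a value at
    every point. *)
Definition is_cderive t f l : Prop :=
  is_derive t 1 (fun x => complex.Re (f x)) (complex.Re l) /\
  is_derive t 1 (fun x => complex.Im (f x)) (complex.Im l).

Lemma is_cderive_cderivable t f l : is_cderive t f l -> cderivable f t.
Proof. by move=> [re im]; split; apply: ex_derive. Qed.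

Lemma is_cderive_cderive t f l : is_cderive t f l -> cderive f t = l.
Proof.
by case: l => a b [re im]; rewrite /cderive !derive1E !derive_val.
Qed.

Lemma cderivable_is_cderive t f : cderivable f t -> is_cderive t f (cderive f t).
Proof. by move=> [re im]; split; rewrite /= derive1E; apply/derivableP. Qed.

Lemma near_is_cderive t f g l :
  (\forall x \near t, f x = g x) -> is_cderive t f l -> is_cderive t g l.
Proof.
move=> fg [re im]; split; [move: re|move: im]; apply: near_eq_is_derive.
  by apply: filterS fg => x ->.
by apply: filterS fg => x ->.
Qed.

Lemma is_cderive_cst t c : is_cderive t (fun=> c) 0.
Proof. by split; apply: is_derive_cst. Qed.

Lemma is_cderiveD t f g l m : is_cderive t f l -> is_cderive t g m ->
  is_cderive t (fun x => f x + g x) (l + m).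
Proof.
case: l m => [a b] [a' b'] [fr fi] [gr gi]; split.
- rewrite (_ : (fun _ => _) = (fun x => complex.Re (f x)) + (fun x => complex.Re (g x))).
    exact: is_deriveD.
  by apply/funext => x; rewrite !fctE; case: (f x) (g x) => [? ?] [].
- rewrite (_ : (fun _ => _) = (fun x => complex.Im (f x)) + (fun x => complex.Im (g x))).
    exact: is_deriveD.
  by apply/funext => x; rewrite !fctE; case: (f x) (g x) => [? ?] [].
Qed.

Lemma is_cderiveM t f g l m : is_cderive t f l -> is_cderive t g m ->
  is_cderive t (fun x => f x * g x) (l * g t + f t * m).
Proof.
case: l m => [a b] [a' b'] [fr fi] [gr gi].
split.
- rewrite (_ : (fun _ => _) = (fun x => complex.Re (f x)) * (fun x => complex.Re (g x))
     - (fun x => complex.Im (f x)) * (fun x => complex.Im (g x))); last first.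
    by apply/funext => x; rewrite !fctE; case: (f x) (g x) => [? ?] [].
  apply: is_derive_eq (is_deriveB (is_deriveM fr gr) (is_deriveM fi gi)) _.
  by case: (f t) (g t) => [u v] [u' v'] /=; rewrite /GRing.scale /=; ring.
- rewrite (_ : (fun _ => _) = (fun x => complex.Re (f x)) * (fun x => complex.Im (g x))
     + (fun x => complex.Im (f x)) * (fun x => complex.Re (g x))); last first.
    by apply/funext => x; rewrite !fctE; case: (f x) (g x) => [? ?] [].
  apply: is_derive_eq (is_deriveD (is_deriveM fr gi) (is_deriveM fi gr)) _.
  by case: (f t) (g t) => [u v] [u' v'] /=; rewrite /GRing.scale /=; ring.
Qed.

Lemma is_cderiveN t f l : is_cderive t f l -> is_cderive t (fun x => - f x) (- l).
Proof.
move=> fl; have := is_cderiveM (is_cderive_cst t (-1)) fl.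
rewrite mul0r add0r mulN1r; congr is_cderive.
by apply/funext => x; rewrite mulN1r.
Qed.

(** One of the real and imaginary parts is nonzero at [t], and it stays so nearby by continuity. *)
Lemma is_cderive_neq0 t f l : is_cderive t f l -> f t != 0 -> \forall x \near t, f x != 0.
Proof.
move=> [fr fi] ft0.
have cont (g : R -> R) u : is_derive t 1 g u -> g x @[x --> t] --> g t.
  move=> gu; apply: differentiable_continuous; apply/derivable1_diffP.
  exact: ex_derive.
have [re0|re0] := eqVneq (complex.Re (f t)) 0.
  have im0 : complex.Im (f t) != 0.
    by apply/eqP => im0; case/negP: ft0; rewrite eq_complex re0 im0 !eqxx.
  have : \forall x \near t, complex.Im (f x) != 0 by exact: cvgr_neq0 _ (cont _ _ fi) im0.
  by apply: filterS => x; apply: contra_neq => ->.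
have : \forall x \near t, complex.Re (f x) != 0 by exact: cvgr_neq0 _ (cont _ _ fr) re0.
by apply: filterS => x; apply: contra_neq => ->.
Qed.

(** The components of 1/f are Re f and -Im f divided by n = |f|^2, a real function that is nonzero
    at [t]. *)
Lemma cderivableV t f l : is_cderive t f l -> f t != 0 ->
  cderivable (fun x => (f x)^-1) t.
Proof.
move=> [fr fi] ft0.
pose n x := complex.Re (f x) * complex.Re (f x) + complex.Im (f x) * complex.Im (f x).
have n0 : n t != 0.
  move: ft0; rewrite /n; case: (f t) => a b /=; apply: contraNneq => /eqP.
  rewrite -!expr2 paddr_eq0 ?sqr_ge0 // !sqrf_eq0 => /andP[/eqP -> /eqP ->].
  by rewrite eqxx.
have nd : derivable (fun x => (n x)^-1) t 1.
  have dn := is_deriveV (f := n) n0 (is_deriveD (is_deriveM fr fr) (is_deriveM fi fi)).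
  exact: ex_derive.
have dr : derivable (fun x => complex.Re (f x)) t 1 by exact: ex_derive.
have di : derivable (fun x => complex.Im (f x)) t 1 by exact: ex_derive.
split.
  rewrite (_ : (fun _ => _) = (fun x => complex.Re (f x)) * (fun x => (n x)^-1)).
    exact: derivableM dr nd.
  by apply/funext => x; rewrite !fctE /n -!expr2; case: (f x) => a b.
rewrite (_ : (fun _ => _) = - ((fun x => complex.Im (f x)) * (fun x => (n x)^-1))).
  exact: derivableN (derivableM di nd).
by apply/funext => x; rewrite !fctE /n -!expr2; case: (f x) => a b.
Qed.

(** Once differentiability is known, the value is forced by differentiating f / f = 1, which holds
    near [t]. *)
Lemma is_cderiveV t f l : is_cderive t f l -> f t != 0 ->
  is_cderive t (fun x => (f x)^-1) (- l / f t ^+ 2).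
Proof.
move=> fl ft0; have gm := cderivable_is_cderive (cderivableV fl ft0).
move: (cderive _ t) gm => m gm; suff -> : - l / f t ^+ 2 = m by [].
have := is_cderive_cderive (is_cderiveM fl gm).
have <- : cderive (fun=> 1) t = cderive (fun x => f x / f x) t.
  rewrite (is_cderive_cderive (is_cderive_cst t 1)); apply/esym/is_cderive_cderive.
  apply: near_is_cderive (is_cderive_cst t 1).
  by apply: filterS (is_cderive_neq0 fl ft0) => x fx0; rewrite divff.
rewrite (is_cderive_cderive (is_cderive_cst t 1)) => /esym/eqP.
rewrite addrC addr_eq0 => /eqP e; apply: (mulfI ft0); rewrite e.
by field.
Qed.

Lemma is_cderive_sum t (I : finType) (P : pred I) (F : I -> R -> C) (dF : I -> C) :
  (forall i, is_cderive t (F i) (dF i)) ->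
  is_cderive t (fun x => \sum_(i | P i) F i x) (\sum_(i | P i) dF i).
Proof.
move=> dFi; elim: (index_enum I) => [|i s IHs].
  under eq_fun do rewrite big_nil; rewrite big_nil; exact: is_cderive_cst.
under eq_fun do rewrite big_cons; rewrite big_cons; case: (P i) => //.
exact: is_cderiveD.
Qed.

Lemma cderivable_cst t c : cderivable (fun=> c) t.
Proof. exact: is_cderive_cderivable (is_cderive_cst t c). Qed.

Lemma cderivableM t f g : cderivable f t -> cderivable g t ->
  cderivable (fun x => f x * g x) t.
Proof.
move=> /cderivable_is_cderive df /cderivable_is_cderive dg.
exact: is_cderive_cderivable (is_cderiveM df dg).
Qed.

Lemma cderivable_sum t (I : finType) (F : I -> R -> C) :
  (forall i, cderivable (F i) t) -> cderivable (fun x => \sum_i F i x) t.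
Proof.
move=> dF; apply: is_cderive_cderivable; apply: is_cderive_sum => i.
exact: cderivable_is_cderive.
Qed.

Lemma cderivable_prod t (I : finType) (F : I -> R -> C) :
  (forall i, cderivable (F i) t) -> cderivable (fun x => \prod_i F i x) t.
Proof.
move=> dF; elim: (index_enum I) => [|i s IHs].
  under eq_fun do rewrite big_nil; exact: cderivable_cst.
by under eq_fun do rewrite big_cons; apply: cderivableM.
Qed.

End ComplexDerivative.

Section MatrixDerivative.
Variable R : realType.
Local Notation C := R[i].
Implicit Type t : R.

Definition is_mxderive m n t (M : R -> 'M[C]_(m, n)) (dM : 'M[C]_(m, n)) : Prop :=
  forall i j, is_cderive t (fun x => M x i j) (dM i j).

Section Basic.
Variables (m n : nat) (t : R).
Implicit Types (M N : R -> 'M[C]_(m, n)).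

Lemma is_mxderive_mxderivable M dM : is_mxderive t M dM -> mxderivable M t.
Proof. by move=> MdM i j; apply: is_cderive_cderivable. Qed.

Lemma is_mxderive_mxderive M dM : is_mxderive t M dM -> mxderive M t = dM.
Proof. by move=> MdM; apply/matrixP => i j; rewrite mxE; apply: is_cderive_cderive. Qed.

Lemma near_is_mxderive M N dM :
  (\forall x \near t, M x = N x) -> is_mxderive t M dM -> is_mxderive t N dM.
Proof.
move=> MN MdM i j; apply: near_is_cderive (MdM i j).
by apply: filterS MN => x ->.
Qed.

Lemma is_mxderive_cst (A : 'M[C]_(m, n)) : is_mxderive t (fun=> A) 0.
Proof. by move=> i j; rewrite mxE; apply: is_cderive_cst. Qed.

Lemma is_mxderiveD M N dM dN : is_mxderive t M dM -> is_mxderive t N dN ->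
  is_mxderive t (fun x => M x + N x) (dM + dN).
Proof.
move=> MdM NdN i j; rewrite mxE; under eq_fun do rewrite mxE.
exact: is_cderiveD.
Qed.

Lemma is_mxderiveZ (f : R -> C) l M dM : is_cderive t f l -> is_mxderive t M dM ->
  is_mxderive t (fun x => f x *: M x) (l *: M t + f t *: dM).
Proof.
move=> fl MdM i j; rewrite !mxE; under eq_fun do rewrite mxE.
exact: is_cderiveM.
Qed.

End Basic.

Lemma is_mxderiveM m n p t (M : R -> 'M[C]_(m, n)) (N : R -> 'M[C]_(n, p)) dM dN :
  is_mxderive t M dM -> is_mxderive t N dN ->
  is_mxderive t (fun x => M x *m N x) (dM *m N t + M t *m dN).
Proof.
move=> MdM NdN i j; rewrite !mxE -big_split /=; under eq_fun do rewrite mxE.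
by apply: is_cderive_sum => l; apply: is_cderiveM.
Qed.

Lemma is_mxderive_mulmx m n p q t (A : 'M[C]_(m, n)) (M : R -> 'M[C]_(n, p))
    (B : 'M[C]_(p, q)) dM :
  is_mxderive t M dM -> is_mxderive t (fun x => A *m M x *m B) (A *m dM *m B).
Proof.
move=> MdM.
have := is_mxderiveM (is_mxderiveM (is_mxderive_cst t A) MdM) (is_mxderive_cst t B).
by rewrite mul0mx add0r mulmx0 addr0.
Qed.

Lemma cderivable_det n t (M : R -> 'M[C]_n) :
  mxderivable M t -> cderivable (fun x => \det (M x)) t.
Proof.
move=> dM; apply: cderivable_sum => s.
apply: cderivableM; first exact: cderivable_cst.
by apply: cderivable_prod => i.
Qed.

Lemma near_unitmx n t (M : R -> 'M[C]_n) : mxderivable M t ->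
  M t \in unitmx -> \forall x \near t, M x \in unitmx.
Proof.
move=> /cderivable_det/cderivable_is_cderive/is_cderive_neq0 dM.
rewrite unitmxE unitfE => /dM; apply: filterS => x.
by rewrite unitmxE unitfE.
Qed.

(** Cramer's formula gives differentiability, since near [t] the inverse is the adjugate over the
    determinant; differentiating M^-1 M = 1 then gives the value. *)
Lemma is_mxderive_invmx n t (M : R -> 'M[C]_n) dM : is_mxderive t M dM ->
  M t \in unitmx ->
  is_mxderive t (fun x => invmx (M x)) (- (invmx (M t) *m dM *m invmx (M t))).
Proof.
move=> MdM Mu; have dMt := is_mxderive_mxderivable MdM.
have uM := near_unitmx dMt Mu.
have dG : mxderivable (fun x => (\det (M x))^-1 *: \adj (M x)) t.
  move=> i j; under eq_fun do rewrite !mxE.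
  apply: cderivableM.
    apply: cderivableV; first exact/cderivable_is_cderive/cderivable_det.
    by rewrite -unitfE -unitmxE.
  apply: cderivableM; first exact: cderivable_cst.
  apply: cderivable_det => i' j'; under eq_fun do rewrite !mxE.
  exact: dMt.
have GdG : is_mxderive t (fun x => invmx (M x))
    (mxderive (fun x => (\det (M x))^-1 *: \adj (M x)) t).
  apply: (near_is_mxderive (M := fun x => (\det (M x))^-1 *: \adj (M x))).
    by apply: filterS uM => x Mx; rewrite /invmx Mx.
  by move=> i j; rewrite mxE; apply: cderivable_is_cderive.
move: (mxderive _ t) GdG => dG' GdG.
suff <- : dG' = - (invmx (M t) *m dM *m invmx (M t)) by [].
have := is_mxderive_mxderive (is_mxderiveM GdG MdM).
have -> : mxderive (fun x => invmx (M x) *m M x) t = 0.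
  apply: is_mxderive_mxderive; apply: near_is_mxderive (is_mxderive_cst t 1%:M).
  by apply: filterS uM => x Mx; rewrite mulVmx.
move=> /esym/eqP; rewrite addr_eq0 => /eqP e.
by rewrite -[dG'](mulmxK Mu) e mulNmx.
Qed.

End MatrixDerivative.

(** * The Jacobi operator *)

Section EisensteinSystem.
Variables (C : numClosedFieldType) (d r : nat) (a z : C).
Variables (H : 'M[C]_d) (V : 'M[C]_(d, r)).
Hypotheses (a0 : a != 0).

Let x := a * (z + z^-1).
Let F := H - x%:M + (z^-1 / a) *: (V *m V^t*).
Hypothesis Fu : F \in unitmx.
Let S := - 1%:M + ((z^-1 - z) / a) *: (V^t* *m invmx F *m V).

(** With g(n) = z^n b + z^-n s, the two equations on the left are those of the core and of the first
    ray vertices, the latter in the form V^* u = a g(0). Solving it for [s] and substituting into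
    the former gives F u = (z^-1 - z) V b. *)
Lemma eisenstein_system n (u : 'M[C]_(d, n)) (b s : 'M[C]_(r, n)) :
  H *m u + V *m (z *: b + z^-1 *: s) = x *: u /\ V^t* *m u = a *: (b + s) <->
  u = (z^-1 - z) *: (invmx F *m V *m b) /\ s = S *m b.
Proof.
have Su : S *m b = - b + a^-1 *: (V^t* *m ((z^-1 - z) *: (invmx F *m V *m b))).
  rewrite /S mulmxDl mulNmx mul1mx -scalemxAl -scalemxAr scalerA !mulmxA.
  by rewrite [_^-1 * _]mulrC.
have FuE : F *m u = H *m u - x *: u + z^-1 *: (V *m (a^-1 *: (V^t* *m u))).
  rewrite /F mulmxDl mulmxBl mul_scalar_mx -scalemxAl -scalemxAr scalerA.
  by rewrite !mulmxA.
have sE : V^t* *m u = a *: (b + s) <-> s = - b + a^-1 *: (V^t* *m u).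
  split=> [->|->]; first by rewrite scalerA mulVf // scale1r addKr.
  by rewrite addNKr scalerA divff // scale1r.
have bsE : s = - b + a^-1 *: (V^t* *m u) ->
    (H *m u + V *m (z *: b + z^-1 *: s) = x *: u <->
     F *m u = (z^-1 - z) *: (V *m b)).
  move=> s_eq; rewrite FuE (_ : a^-1 *: _ = b + s); last by rewrite s_eq addNKr.
  rewrite !mulmxDr -!scalemxAr scalerBl scalerDr.
  move: (H *m u) (V *m b) (V *m s) => Hu Vb Vs.
  split=> [/eqP|/eqP]; rewrite -subr_eq0 => /eqP h;
    apply/eqP; rewrite -subr_eq0; apply/eqP.
    by rewrite -h; apply/matrixP => i j; rewrite !mxE; ring.
  by rewrite -h; apply/matrixP => i j; rewrite !mxE; ring.
split=> [[h1 /sE h2]|[h1 h2]].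
  have uE : u = (z^-1 - z) *: (invmx F *m V *m b).
    have /(congr1 (mulmx (invmx F))) := (bsE h2).1 h1.
    by rewrite mulKmx // -scalemxAr mulmxA.
  by split => //; rewrite Su -uE.
have h3 : s = - b + a^-1 *: (V^t* *m u) by rewrite h2 Su h1.
split; last exact/sE.
by apply/(bsE h3); rewrite h1 -scalemxAr !mulmxA mulmxV // mul1mx.
Qed.

End EisensteinSystem.

Section Jacobi.
Variables (R : realType) (k : finFieldType) (Gamma : subgroup (PGL2 (laurent k))).
Hypothesis stab_fin : forall v, finite_set (stab Gamma v).
Local Notation C := R[i].
Local Notation Y := (quotient_vertex Gamma).
Implicit Types (y z : Y) (f : Y -> C).

Definition rweight y : C := (Num.sqrt (weight R y))%:C.

Lemma weight_gt0 y : 0 < weight R y.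
Proof. by rewrite /weight invr_gt0 ltr0n card_stab_gt0. Qed.

Lemma rweight_neq0 y : rweight y != 0.
Proof. by rewrite /rweight fmorph_eq0 sqrtr_eq0 -ltNge weight_gt0. Qed.

Lemma rweight_sqr y : rweight y * rweight y = (weight R y)%:C.
Proof. by rewrite /rweight -rmorphM /= -expr2 sqr_sqrtr // ltW // weight_gt0. Qed.

Lemma rweightJ y : (rweight y)^* = rweight y.
Proof. exact: conjc_real. Qed.

Lemma jacobi_indic y z :
  jacobi (Defs.indic R z) y = rweight y * (nb_edges y z)%:R / rweight z.
Proof.
rewrite /jacobi (adjacency_sum stab_fin) -/(rweight y) -mulrA; congr (_ * _).
rewrite -(fsbig_widen [set z]) => //.
  by rewrite fsbig_set1 /Defs.indic eqxx mulr1.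
by move=> z' [_ /= /eqP/negPf zz']; rewrite /Defs.indic zz' !mulr0.
Qed.

Lemma jacobi_real y z : (jacobi (Defs.indic R z) y)^* = jacobi (Defs.indic R z) y.
Proof. by rewrite jacobi_indic !rmorphM fmorphV /= !rweightJ rmorph_nat. Qed.

(** Multiplying by the roots of both weights, which are inverse stabilizer orders, turns this into
    [nb_edges_sym]. *)
Lemma jacobi_sym y z : jacobi (Defs.indic R z) y = jacobi (Defs.indic R y) z.
Proof.
rewrite !jacobi_indic; apply: (mulfI (rweight_neq0 y)); apply: (mulIf (rweight_neq0 z)).
rewrite !mulrA (divfK (rweight_neq0 z)) rweight_sqr.
rewrite [RHS](_ : _ = rweight z * rweight z * (nb_edges z y)%:R); last first.
  by move: (rweight_neq0 y) => ry; field.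
rewrite rweight_sqr /weight.
have s0 v : (card_set (stab Gamma v))%:R != 0 :> C.
  by rewrite pnatr_eq0 -lt0n card_stab_gt0.
rewrite !fmorphV /= !rmorph_nat; apply: (mulfI (s0 (repr y))); apply: (mulfI (s0 (repr z))).
have /(congr1 (fun n => n%:R : C)) := nb_edges_sym stab_fin y z.
by rewrite !natrM mulVKf // mulrCA mulVKf // mulrC => ->; rewrite mulrC.
Qed.

(** The intertwining U A = J U, with J written through its matrix entries. *)
Lemma rweight_adjacency f y : rweight y * adjacency f y =
  \sum_(z \in [set: Y]) jacobi (Defs.indic R z) y * (rweight z * f z).
Proof.
rewrite (adjacency_sum stab_fin) mulr_fsumr; apply: eq_fsbigr => z _.
by rewrite jacobi_indic [RHS]mulrA divfK ?rweight_neq0 // mulrA.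
Qed.

End Jacobi.

Section CuspEquations.
Variables (R : realType) (k : finFieldType) (Gamma : subgroup (PGL2 (laurent k))).
Hypothesis stab_fin : forall v, finite_set (stab Gamma v).
Variables (d r : nat) (X : cusp_decomposition R Gamma d r).
Local Notation C := R[i].
Local Notation Y := (quotient_vertex Gamma).
Local Notation q := (#|k|).
Local Notation a := (sqrtq R k).
Local Notation H := (core_matrix X).
Local Notation V := (core_ray_matrix X).
Implicit Types (y z : Y) (f : Y -> C).

Let q_gt0 : 0 < (q%:R : R).
Proof. by rewrite ltr0n; apply/card_gt0P; exists 0. Qed.

Lemma sqrtq_neq0 : a != 0.
Proof. by rewrite /sqrtq fmorph_eq0 sqrtr_eq0 -ltNge. Qed.

Lemma sqrtqJ : a^* = a.
Proof. exact: conjc_real. Qed.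

Lemma sqrtq_sqr : a * a = q%:R.
Proof. by rewrite /sqrtq -rmorphM /= -expr2 sqr_sqrtr ?ltW // rmorph_nat. Qed.

Lemma core_matrix_herm : H^t* = H.
Proof.
by apply/matrixP => i j; rewrite !mxE jacobi_real // jacobi_sym.
Qed.

Lemma indic_core_ray i c n : (0 < n)%N -> Defs.indic R (core X i) (ray X c n) = 0.
Proof.
by move=> n0; rewrite /Defs.indic; case: eqP => // /esym/(core_ray n0).
Qed.

(** At (c,n) the operator A involves (c,n-1) and (c,n+1) only, both on the ray. There is thus no
    edge from (c,n) to the core, and [nb_edges_eq0] reverses the direction. *)
Lemma nb_edges_core_ray i c n : (2 <= n)%N -> nb_edges (core X i) (ray X c n) = 0%N.
Proof.
move=> n2; apply: nb_edges_eq0 => //; apply/eqP; rewrite -(eqr_nat C).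
have n1 : (0 < n.-1)%N by case: n n2 => [|[]].
rewrite -(adjacency_indic R stab_fin) adjacency_ray //.
by rewrite !indic_core_ray // mulr0 addr0.
Qed.

(** The indicator of a ray vertex vanishes on the core, so [adjacency_ray1] can be tested on it. *)
Lemma nb_edges_ray1 c c' n : (0 < n)%N ->
  nb_edges (ray X c 1) (ray X c' n) = ((c' == c) && (n == 2)) :> nat.
Proof.
move=> n0; apply/eqP; rewrite -(eqr_nat C); apply/eqP.
rewrite -(adjacency_indic R stab_fin) adjacency_ray1 /Defs.indic => [|i]; last first.
  by case: eqP => // /(core_ray n0).
congr (_%:R); congr nat_of_bool; apply/eqP/andP => [|[/eqP -> /eqP ->]] //.
by case/(ray_inj (isT : (0 < 2)%N) n0) => -> <-.
Qed.

(** The part of lambda(c,n)^(1/2) that does not depend on n; the other factor is a^-n. *)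
Definition cusp_scale (c : 'I_r) : C := (Num.sqrt (width X c * (q%:R + 1)))%:C.

Lemma rweight_ray c n : (0 < n)%N -> rweight R (ray X c n) = cusp_scale c * a ^- n.
Proof.
move=> n0; rewrite /rweight weight_ray // /cusp_scale /sqrtq.
have w0 : 0 <= width X c * (q%:R + 1).
  by rewrite mulr_ge0 ?addr_ge0 ?ler0n // ltW // width_gt0.
rewrite sqrtrM // rmorphM /= sqrtrV ?exprn_ge0 ?ltW // fmorphV /=.
have -> : (q%:R : R) ^+ n = (Num.sqrt q%:R ^+ n) ^+ 2.
  by rewrite exprAC sqr_sqrtr // ltW.
by rewrite sqrtr_sqr ger0_norm ?exprn_ge0 ?sqrtr_ge0 // rmorphXn.
Qed.

Lemma cusp_scale_neq0 c : cusp_scale c != 0.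
Proof.
by rewrite fmorph_eq0 sqrtr_eq0 -ltNge mulr_gt0 ?width_gt0 //.

Qed.

Lemma adjacency_core f i : rweight R (core X i) * adjacency f (core X i) =
  \sum_j H i j * (rweight R (core X j) * f (core X j)) +
  \sum_c V i c * (rweight R (ray X c 1) * f (ray X c 1)).
Proof.
rewrite rweight_adjacency //.
pose h (t : 'I_d + 'I_r) := match t with inl j => core X j | inr c => ray X c 1 end.
rewrite (@fsbig_fintype _ _ _ h).
- rewrite big_sumType /=; congr (_ + _); apply: eq_bigr => t _; by rewrite mxE.
- move=> [j|c] [j'|c'] /=.
  + by move/core_inj => ->.
  + by move/(core_ray (isT : (0 < 1)%N)).
  + by move/esym/(core_ray (isT : (0 < 1)%N)).
  + by case/(ray_inj (isT : (0 < 1)%N) (isT : (0 < 1)%N)) => ->.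
- move=> y yh; rewrite jacobi_indic //.
  have [[j yj]|[c [n [n0 yc]]]] := core_ray_cover X y; first by case: (yh (inl j)).
  have n2 : (2 <= n)%N by case: n n0 yc => [|[|]] // _ yc; case: (yh (inr c)).
  by rewrite yc nb_edges_core_ray // mulr0 !mul0r.
Qed.

Lemma adjacency_first_ray f c : rweight R (ray X c 1) * adjacency f (ray X c 1) =
  \sum_j V j c * (rweight R (core X j) * f (core X j)) +
  a * (rweight R (ray X c 2) * f (ray X c 2)).
Proof.
rewrite rweight_adjacency //.
pose h (t : 'I_d + 'I_1) := match t with inl j => core X j | inr _ => ray X c 2 end.
rewrite (@fsbig_fintype _ _ _ h).
- rewrite big_sumType /= big_ord1; congr (_ + _).
    by apply: eq_bigr => t _; rewrite mxE jacobi_sym.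
  (* The edge of index 1 to (c,2) acquires the coefficient a, the quotient of the weight roots at
     levels 1 and 2. *)
  rewrite jacobi_indic // nb_edges_ray1 // !eqxx mulr1 !rweight_ray //; congr (_ * _).
  by move: sqrtq_neq0 (cusp_scale_neq0 c) => a0 c0; field; rewrite a0.
- move=> [j|c1] [j'|c2] /=.
  + by move/core_inj => ->.
  + by move/(core_ray (isT : (0 < 2)%N)).
  + by move/esym/(core_ray (isT : (0 < 2)%N)).
  + by rewrite (ord1 c1) (ord1 c2).
- move=> y yh; rewrite jacobi_indic //.
  have [[j yj]|[c' [n [n0 yc]]]] := core_ray_cover X y; first by case: (yh (inl j)).
  rewrite yc nb_edges_ray1 //.
  case: andP => [[/eqP ec /eqP en]|_]; last by rewrite mulr0 !mul0r.
  by case: (yh (inr ord0)); rewrite yc ec en.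
Qed.

Definition cusp_scale_mx : 'M[C]_r := diag_mx (\row_c cusp_scale c).

Definition core_vector f : 'cV[C]_d := \col_i (rweight R (core X i) * f (core X i)).

Section RayExpansion.
Variables (z : C) (b s : 'cV[C]_r) (f : Y -> C).
Hypothesis z0 : z != 0.
Hypothesis f_ray : forall c n, (0 < n)%N ->
  f (ray X c n) = (a * z) ^+ n * b c 0 + (a / z) ^+ n * s c 0.

Let x := a * (z + z^-1).

Lemma ray_vector c n : (0 < n)%N ->
  rweight R (ray X c n) * f (ray X c n) =
  (z ^+ n *: (cusp_scale_mx *m b) + z ^- n *: (cusp_scale_mx *m s)) c 0.
Proof.
move=> n0; rewrite rweight_ray // f_ray // /cusp_scale_mx !mul_diag_mx !mxE.
rewrite !exprMn exprVn; have an : a ^+ n != 0 by rewrite expf_neq0 // sqrtq_neq0.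
have zn : z ^+ n != 0 by rewrite expf_neq0.
by field; rewrite zn an.
Qed.

Lemma eigen_ray c n : (2 <= n)%N -> adjacency f (ray X c n) = x * f (ray X c n).
Proof.
case: n => [|[|n]] // _; rewrite adjacency_ray // !f_ray //= -sqrtq_sqr /x.
by rewrite !exprS; field.
Qed.

(** From level 2 on, the cusp expansion solves the recurrence by itself ([eigen_ray]), so the
    infinite system reduces to the core and the first ray vertices. *)
Lemma eigenfunctionP : (forall y, adjacency f y = x * f y) <->
  H *m core_vector f + V *m (z *: (cusp_scale_mx *m b) + z^-1 *: (cusp_scale_mx *m s))
    = x *: core_vector f /\
  V^t* *m core_vector f = a *: (cusp_scale_mx *m b + cusp_scale_mx *m s).
Proof.
set b' := _ *m b; set s' := _ *m s.
have coreE i : rweight R (core X i) * adjacency f (core X i) =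
    (H *m core_vector f + V *m (z *: b' + z^-1 *: s')) i 0.
  rewrite adjacency_core !mxE; congr (_ + _); apply: eq_bigr => j _.
    by rewrite [core_vector f j 0]mxE.
  by congr (_ * _); exact: (ray_vector j (isT : (0 < 1)%N)).
have rayE c : rweight R (ray X c 1) * adjacency f (ray X c 1) =
    (V^t* *m core_vector f) c 0 + a * (z ^+ 2 *: b' + z ^- 2 *: s') c 0.
  rewrite adjacency_first_ray ray_vector // !mxE; congr (_ + _).
  by apply: eq_bigr => j _; rewrite !mxE jacobi_real.
(* The recurrence continued to level 0: x g(1) = a g(0) + a g(2) with g(0) = b' + s'. *)
have ray1E c : x * (rweight R (ray X c 1) * f (ray X c 1)) =
    (a *: (b' + s')) c 0 + a * (z ^+ 2 *: b' + z ^- 2 *: s') c 0.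
  rewrite ray_vector // !mxE /x; move: (\sum_j _) (\sum_j _) => t1 t2.
  by field.
split=> [eigen|[h1 h2] y].
  split; apply/matrixP => i j; rewrite (ord1 j).
    by rewrite -coreE eigen !mxE mulrCA.
  by have := rayE i; rewrite eigen mulrCA ray1E => /addIr.
have [[i ->]|[c [n [n0 ->]]]] := core_ray_cover X y.
  by apply: (mulfI (rweight_neq0 R stab_fin (core X i))); rewrite coreE h1 !mxE mulrCA.
case: n n0 => [|[|n]] // _; last exact: eigen_ray.
apply: (mulfI (rweight_neq0 R stab_fin (ray X c 1))).
by rewrite rayE mulrCA ray1E h2.
Qed.

End RayExpansion.
End CuspEquations.

(** * Complex exponentials and the unit circle *)

Section Exponentials.
Variable R : realType.
Local Notation C := R[i].
Implicit Types (t : R) (w : C).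

Lemma cexpD w1 w2 : cexp (w1 + w2) = cexp w1 * cexp w2.
Proof.
case: w1 w2 => [x1 y1] [x2 y2]; rewrite /cexp /= expRD cosD sinD.
apply/eqP; rewrite eq_complex /=; apply/andP; split; apply/eqP; ring.
Qed.

Lemma cexp0 : cexp 0 = 1 :> C.
Proof. by rewrite /cexp /= expR0 cos0 sin0 mul1r. Qed.

Lemma cexpMn w n : cexp (n%:R * w) = cexp w ^+ n.
Proof.
elim: n => [|n IHn]; first by rewrite mul0r cexp0.
by rewrite -natr1 mulrDl mul1r cexpD IHn exprSr.
Qed.

Lemma cexp_real t : cexp t%:C = (expR t)%:C.
Proof. by rewrite /cexp /= cos0 sin0 mulr1. Qed.

Lemma expiE t : expi t = cos t +i* sin t :> C.
Proof.
rewrite /expi -complexiE /cexp /= !(mul0r, mul1r, mulr0, subr0, addr0, add0r).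
by rewrite oppr0 expR0 mul1r.
Qed.

Lemma expiD t u : expi (t + u) = expi t * expi u :> C.
Proof. by rewrite /expi rmorphD mulrDr cexpD. Qed.

Lemma expi0 : expi 0 = 1 :> C.
Proof. by rewrite /expi rmorph0 mulr0 cexp0. Qed.

Lemma expi_neq0 t : expi t != 0 :> C.
Proof.
apply/eqP => t0; have /eqP := oner_neq0 C; apply.
by rewrite -expi0 -(subrr t) expiD t0 mul0r.
Qed.

Lemma expiN t : expi (- t) = (expi t : C)^-1.
Proof.
apply: (mulfI (expi_neq0 t)); rewrite -expiD subrr expi0 divff //.
exact: expi_neq0.
Qed.

Lemma expiMn t n : expi (n%:R * t) = expi t ^+ n :> C.
Proof. by rewrite /expi -cexpMn rmorphM rmorph_nat mulrCA. Qed.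

Lemma expiJ t : (expi t)^* = (expi t : C)^-1.
Proof. by rewrite -expiN !expiE cosN sinN. Qed.

Lemma expiV_sub t : (expi t)^-1 - expi t = - (2 * 'i * (sin t)%:C) :> C.
Proof.
rewrite -expiN !expiE cosN sinN -complexiE.
apply/eqP; rewrite eq_complex /=; apply/andP; split; apply/eqP; ring.
Qed.

Lemma is_cderive_expi t : is_cderive t (fun x => expi x : C) ('i * expi t).
Proof.
rewrite /is_cderive; under eq_fun do rewrite expiE /=.
under [X in _ /\ is_derive _ _ X _]eq_fun do rewrite expiE /=.
rewrite expiE -complexiE /=; split; apply: is_derive_eq.
- by rewrite mul0r mul1r sub0r.
- by rewrite mul0r mul1r add0r.
Qed.

End Exponentials.

(** * The Eisenstein family *)

Section Eisenstein.
Variables (R : realType) (k : finFieldType) (Gamma : subgroup (PGL2 (laurent k))).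
Hypothesis stab_fin : forall v, finite_set (stab Gamma v).
Variables (d r : nat) (X : cusp_decomposition R Gamma d r).
Local Notation C := R[i].
Local Notation Y := (quotient_vertex Gamma).
Local Notation q := (#|k|).
Local Notation a := (sqrtq R k).
Local Notation V := (core_ray_matrix X).
Local Notation D := (cusp_scale_mx X).
Implicit Types (f : Y -> C) (b s : 'cV[C]_r).

Let ln_q_neq0 : ln (q%:R : R) != 0.
Proof. by rewrite gt_eqF // ln_gt0 // ltr1n card_finNzRing_gt1. Qed.

Lemma cexp_half_ln : cexp (2^-1 * (ln (q%:R : R))%:C) = a.
Proof.
have q0 : 0 < (q%:R : R) by rewrite ltr0n ltnW // card_finNzRing_gt1.
rewrite (_ : 2^-1 = (2^-1)%:C); last by rewrite fmorphV rmorph_nat.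
rewrite -rmorphM cexp_real /sqrtq; congr (_%:C).
rewrite -[in RHS](lnK q0); move: (ln _) => l.
have {2}-> : l = 2^-1 * l + 2^-1 * l by field.
by rewrite expRD -expr2 sqrtr_sqr ger0_norm ?expR_ge0.
Qed.

(** The denominator ln q in [s_theta] cancels, so that zeta = q^(s-1/2) is exactly [expi t]. *)
Lemma qpow_s_theta t n : qpow k (n%:R * s_theta k t) = (a * expi t) ^+ n.
Proof.
rewrite /qpow -mulrA cexpMn /s_theta mulrDl cexpD cexp_half_ln -mulrA -rmorphM /=.
by rewrite divfK.
Qed.

Lemma qpow_1s_theta t n : qpow k (n%:R * (1 - s_theta k t)) = (a / expi t) ^+ n.
Proof.
have -> : 1 - s_theta k t = s_theta k (- t) :> C.
  rewrite /s_theta mulNr rmorphN mulrN opprD addrA; congr (_ - _).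
  by field.
by rewrite qpow_s_theta expiN.
Qed.

Section FixedAngle.
Variable t : R.
Local Notation z := (expi t : C).
Local Notation F := (Fmx X z).
Local Notation S := (Smx X z).
Let x := a * (z + z^-1).
Let delta := z^-1 - z.
Hypothesis Fu : F \in unitmx.

Lemma eisenstein_withP b s f : eisenstein_with X (s_theta k t) b s f <->
  [/\ forall c n, (0 < n)%N ->
        f (ray X c n) = (a * z) ^+ n * b c 0 + (a / z) ^+ n * s c 0,
      core_vector X f = delta *: (invmx F *m V *m (D *m b)) &
      D *m s = S *m (D *m b)].
Proof.
have xE : qpow k (s_theta k t) + qpow k (1 - s_theta k t) = x.
  have := qpow_s_theta t 1; have := qpow_1s_theta t 1.
  by rewrite !mul1r !expr1 => -> ->; rewrite -mulrDr.
have sys := eisenstein_system (H := core_matrix X) (sqrtq_neq0 R k) Fu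
  (core_vector X f) (D *m b) (D *m s).
split=> [[eig ray_f]|[ray_f cv Ds]].
  have f_ray c n : (0 < n)%N ->
      f (ray X c n) = (a * z) ^+ n * b c 0 + (a / z) ^+ n * s c 0.
    by move=> n0; rewrite ray_f // qpow_s_theta qpow_1s_theta.
  rewrite xE in eig.
  have [] := sys.1 ((eigenfunctionP stab_fin (expi_neq0 t) f_ray).1 eig).
  by split.
split=> [|c n n0]; last by rewrite qpow_s_theta qpow_1s_theta ray_f.
by rewrite xE; apply/(eigenfunctionP stab_fin (expi_neq0 t) ray_f)/sys.
Qed.

Lemma vertex_function (g : 'I_d -> C) (h : 'I_r -> nat -> C) : exists f,
  (forall i, f (core X i) = g i) /\ (forall c n, (0 < n)%N -> f (ray X c n) = h c n).
Proof.
have /choice[f fP] : forall y : Y, exists v : C,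
    (forall i, y = core X i -> v = g i) /\
    (forall c n, (0 < n)%N -> y = ray X c n -> v = h c n).
  move=> y; have [[i ->]|[c [n [n0 ->]]]] := core_ray_cover X y.
    exists (g i); split=> [j /core_inj -> //|c n n0 /(core_ray n0)] //.
  exists (h c n); split=> [j /esym/(core_ray n0) //|c' n' n0' ].
  by move=> /(ray_inj n0 n0')[-> ->].
exists f; split=> [i|c n n0]; first exact: (fP _).1.
exact: (fP _).2.
Qed.

Lemma cusp_scale_mx_unit : D \in unitmx.
Proof.
rewrite unitmxE det_diag unitfE; apply/prodf_neq0 => c _.
by rewrite mxE cusp_scale_neq0.
Qed.

Lemma eisenstein_exists b s : D *m s = S *m (D *m b) ->
  exists f, eisenstein_with X (s_theta k t) b s f.
Proof.
move=> Ds; pose u := delta *: (invmx F *m V *m (D *m b)).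
have [f [fcore fray]] := vertex_function
  (fun i => (rweight R (core X i))^-1 * u i 0)
  (fun c n => (a * z) ^+ n * b c 0 + (a / z) ^+ n * s c 0).
exists f; apply/eisenstein_withP; split => //; rewrite -/u.
by apply/matrixP => i j; rewrite (ord1 j) mxE fcore mulVKf // rweight_neq0.
Qed.

Let conjD_system b : D *m (invmx D *m (S *m D) *m b) = S *m (D *m b).
Proof. by rewrite -mulmxA (mulKVmx cusp_scale_mx_unit) -mulmxA. Qed.

(** This matrix is admissible by [eisenstein_exists]. Any matrix chosen by [xget] agrees with it on
    every [b], because [eisenstein_withP] determines D sigma and D is invertible. *)
Lemma SautE : Saut X (s_theta k t) = invmx D *m (S *m D).
Proof.
have ex : [set S' | forall b, exists f, eisenstein_with X (s_theta k t) b (S' *m b) f]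
    (invmx D *m (S *m D)) by move=> b; exact/eisenstein_exists/conjD_system.
have all_b := xgetPex 0 (ex_intro _ _ ex).
have Sb b : Saut X (s_theta k t) *m b = invmx D *m (S *m D) *m b.
  have [f /eisenstein_withP[_ _ e]] := all_b b.
  rewrite -[LHS](mulKmx cusp_scale_mx_unit) e -conjD_system.
  exact: (mulKmx cusp_scale_mx_unit).
by apply/matrixP => i j; rewrite -mulmx_deltaE Sb mulmx_deltaE.
Qed.

Lemma eisensteinP b :
  eisenstein_with X (s_theta k t) b (Saut X (s_theta k t) *m b)
    (eisenstein X (s_theta k t) b).
Proof.
apply: (@xgetPex _ _ [set f | eisenstein_with X (s_theta k t) b
  (Saut X (s_theta k t) *m b) f]).
by apply: eisenstein_exists; rewrite SautE conjD_system.
Qed.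

Lemma inner_chi N f g : inner (chi X N f) g =
  \sum_i core_vector X f i 0 * (core_vector X g i 0)^* +
  \sum_(n < N) \sum_c (rweight R (ray X c n.+1) * f (ray X c n.+1)) *
                      (rweight R (ray X c n.+1) * g (ray X c n.+1))^*.
Proof.
rewrite /inner.
pose h (p : 'I_d + 'I_N * 'I_r) :=
  match p with inl i => core X i | inr (n, c) => ray X c n.+1 end.
have wt y : f y * (g y)^* * (weight R y)%:C = (rweight R y * f y) * (rweight R y * g y)^*.
  by rewrite rmorphM /= rweightJ -rweight_sqr //; ring.
rewrite (@fsbig_fintype _ _ _ h).
- rewrite big_sumType /=; congr (_ + _).
    apply: eq_bigr => i _; rewrite -[chi _ _ _ _]/(if _ then _ else _).
    rewrite asboolT; last by left; exists i.
    by rewrite wt !mxE.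
  rewrite pair_big /=; apply: eq_bigr => -[n c] _ /=.
  rewrite /chi asboolT; last by right; exists c, n.+1; rewrite /= ltn_ord.
  by rewrite wt.
- move=> [i|[n c]] [i'|[n' c']] //=.
  + by move/core_inj => ->.
  + by move/core_ray => /(_ isT).
  + by move/esym/core_ray => /(_ isT).
  + by case/ray_inj => // -> [/val_inj ->].
- move=> y yh; rewrite /chi asboolF ?mul0r // => -[[i yi]|[c [n [/andP[n0 nN] yc]]]].
    by case: (yh (inl i)).
  case: n n0 nN yc => // n _ nN yc.
  by case: (yh (inr (Ordinal nN, c))).
Qed.

Lemma truncated_gramE N : truncated_gram X N (s_theta k t) =
  D *m ((delta *: (invmx F *m V))^t* *m (delta *: (invmx F *m V)) +
    \sum_(n < N) (z ^+ n.+1 *: 1%:M + z ^- n.+1 *: S)^t* *m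
                 (z ^+ n.+1 *: 1%:M + z ^- n.+1 *: S)) *m D.
Proof.
have DJ : D^t* = D.
  apply/matrixP => i j; rewrite !mxE eq_sym; case: eqP => [->|_].
    by rewrite mulr1n; exact: conjc_real.
  by rewrite mulr0n rmorph0.
(* Column c of [U], respectively of [G n], holds the values of the c-th Eisenstein function on the
   core, respectively at level n of the rays, multiplied by lambda^(1/2). *)
pose U := delta *: (invmx F *m V) *m D.
pose G n := (z ^+ n *: 1%:M + z ^- n *: S) *m D.
transitivity (U^t* *m U + \sum_(n < N) (G n.+1)^t* *m G n.+1); last first.
  rewrite mulmxDr mulmxDl mulmx_sumr mulmx_suml /U adjmxM DJ !mulmxA; congr (_ + _).
  by apply: eq_bigr => n _; rewrite /G adjmxM DJ !mulmxA.
have coreE c i : core_vector X (eisenstein X (s_theta k t) (delta_mx c 0)) i 0 = U i c.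
  have /eisenstein_withP[_ -> _] := eisensteinP (delta_mx c 0).
  by rewrite -[RHS]mulmx_deltaE /U -!scalemxAl -!mulmxA.
have rayE c c' n : (0 < n)%N -> rweight R (ray X c n) *
    eisenstein X (s_theta k t) (delta_mx c' 0) (ray X c n) = G n c c'.
  move=> n0; have /eisenstein_withP[fray _ Ds] := eisensteinP (delta_mx c' 0).
  rewrite (ray_vector (expi_neq0 t) fray) // Ds -[RHS]mulmx_deltaE /G -mulmxA.
  by rewrite (mulmxDl (_ *: 1%:M)) -(scalemxAl _ 1%:M) mul1mx -(scalemxAl _ S).
clearbody U G.
apply/matrixP => c c'; rewrite [LHS]mxE inner_chi [RHS]mxE; congr (_ + _).
  rewrite [RHS]mxE; apply: eq_bigr => i _.
  by rewrite adjmxE mulrC; congr (_^* * _); exact: coreE.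
rewrite summxE; apply: eq_bigr => n _; rewrite [RHS]mxE; apply: eq_bigr => i _.
by rewrite adjmxE mulrC; congr (_^* * _); exact: rayE.
Qed.

End FixedAngle.
End Eisenstein.

(** * The derivative of the scattering matrix *)

Section ScatteringDerivative.
Variables (R : realType) (k : finFieldType) (Gamma : subgroup (PGL2 (laurent k))).
Variables (d r : nat) (X : cusp_decomposition R Gamma d r).
Variable t : R.
Local Notation C := R[i].
Local Notation a := (sqrtq R k).
Local Notation z := (expi t : C).
Local Notation V := (core_ray_matrix X).

Lemma is_cderive_expiV : is_cderive t (fun u => (expi u : C)^-1) (- 'i * z^-1).
Proof.
have := is_cderiveV (is_cderive_expi t) (expi_neq0 t); congr is_cderive.
by have z0 := expi_neq0 t; field.
Qed.

(** Kept in the shape of [dF], so that [adjS_dS_herm] and [truncated_gram_formula] apply by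
    conversion. *)
Definition Fmx_deriv : 'M[C]_d :=
  - (a * ('i * z - 'i * z^-1))%:M + (- 'i * z^-1 / a) *: (V *m V^t*).

Lemma is_mxderive_Fmx : is_mxderive t (fun u => Fmx X (expi u)) Fmx_deriv.
Proof.
have dx : is_cderive t (fun u => - (a * ((expi u : C) + (expi u)^-1)))
    (- (a * ('i * z - 'i * z^-1))).
  have := is_cderiveN (is_cderiveM (is_cderive_cst t a)
    (is_cderiveD (is_cderive_expi t) is_cderive_expiV)).
  by rewrite mul0r add0r mulNr.
have dv := is_cderiveM is_cderive_expiV (is_cderive_cst t a^-1).
have := is_mxderiveD (is_mxderive_cst t (core_matrix X)) (is_mxderiveD
  (is_mxderiveZ dx (is_mxderive_cst t 1%:M))
  (is_mxderiveZ dv (is_mxderive_cst t (V *m V^t*)))).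
rewrite !scaler0 !addr0 add0r mulr0 addr0 scalemx1 raddfN -/Fmx_deriv.
congr is_mxderive; apply/funext => u.
by rewrite /Fmx /spectral_param addrA scalemx1 raddfN.
Qed.

Hypothesis Fu : Fmx X z \in unitmx.
Let G := invmx (Fmx X z).

Definition Smx_deriv : 'M[C]_r :=
  ((- 'i * z^-1 - 'i * z) / a) *: (V^t* *m G *m V) +
  ((z^-1 - z) / a) *: (V^t* *m (- (G *m Fmx_deriv *m G)) *m V).

Lemma is_mxderive_Smx : is_mxderive t (fun u => Smx X (expi u)) Smx_deriv.
Proof.
have dk := is_cderiveM (is_cderiveD is_cderive_expiV (is_cderiveN (is_cderive_expi t)))
  (is_cderive_cst t a^-1).
have := is_mxderiveD (is_mxderive_cst t (- 1%:M)) (is_mxderiveZ dk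
  (is_mxderive_mulmx (V^t*) V (is_mxderive_invmx is_mxderive_Fmx Fu))).
by rewrite add0r mulr0 addr0.
Qed.

End ScatteringDerivative.

(** * Cusp widths and conjugation by W^(1/2) *)

Section Width.
Variables (R : realType) (k : finFieldType) (Gamma : subgroup (PGL2 (laurent k))).
Variables (d r : nat) (X : cusp_decomposition R Gamma d r).
Local Notation C := R[i].

Definition width_mx_sqrt : 'M[C]_r := diag_mx (\row_c (Num.sqrt (width X c))%:C).
Local Notation W := (width_mx X).
Local Notation Wh := width_mx_sqrt.
Local Notation Wi := (width_mx_isqrt X).

Let sqrtw_neq0 c : Num.sqrt (width X c) != 0.
Proof. by rewrite sqrtr_eq0 -ltNge width_gt0. Qed.

Lemma mul_width_mx_sqrt : Wh *m Wh = W.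
Proof.
rewrite mulmx_diag; congr diag_mx; apply/rowP => c; rewrite !mxE -rmorphM /=.
by rewrite -expr2 sqr_sqrtr // ltW // width_gt0.
Qed.

Lemma width_mx_isqrtK : Wi *m Wh = 1%:M.
Proof.
rewrite mulmx_diag -diag_const_mx; congr diag_mx; apply/rowP => c.
by rewrite !mxE -rmorphM /= mulVf.
Qed.

Lemma adj_diag_real n (v : 'rV[R]_n) :
  (diag_mx (\row_c (v 0 c)%:C) : 'M[C]_n)^t* = diag_mx (\row_c (v 0 c)%:C).
Proof.
apply/matrixP => i j; rewrite !mxE eq_sym; case: eqP => [->|_].
  by rewrite mulr1n; exact: conjc_real.
by rewrite mulr0n rmorph0.
Qed.

Lemma adj_width_mx_sqrt : Wh^t* = Wh.
Proof.
by have := adj_diag_real (\row_c Num.sqrt (width X c)); under eq_mx do rewrite mxE.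
Qed.

Lemma adj_width_mx_isqrt : Wi^t* = Wi.
Proof.
by have := adj_diag_real (\row_c (Num.sqrt (width X c))^-1); under eq_mx do rewrite mxE.
Qed.

Local Notation s1 := ((Num.sqrt (#|k|%:R + 1))%:C : C).

Lemma cusp_scale_mxE : cusp_scale_mx X = s1 *: Wh.
Proof.
apply/matrixP => i j; rewrite !mxE /cusp_scale sqrtrM ?ltW ?width_gt0 // rmorphM /=.
by rewrite mulrC mulrnAr.
Qed.

Lemma s1_neq0 : s1 != 0.
Proof. by rewrite fmorph_eq0 sqrtr_eq0 -ltNge ltr_wpDl. Qed.

Lemma s1_sqr : s1 * s1 = #|k|%:R + 1.
Proof. by rewrite -rmorphM /= -expr2 sqr_sqrtr ?addr_ge0 // rmorphD rmorph_nat rmorph1. Qed.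

(** The scalar sqrt(q+1) in [cusp_scale_mxE] cancels, and only the widths remain in the
    conjugation. *)
Lemma cusp_scale_conj (S : 'M[C]_r) :
  invmx (cusp_scale_mx X) *m (S *m cusp_scale_mx X) = Wi *m S *m Wh.
Proof.
have -> : invmx (cusp_scale_mx X) = s1^-1 *: Wi.
  have e : s1^-1 *: Wi *m cusp_scale_mx X = 1%:M.
    rewrite cusp_scale_mxE -scalemxAl -scalemxAr scalerA width_mx_isqrtK.
    by rewrite mulVf ?s1_neq0 // scale1r.
  by rewrite -[RHS](mulmxK (cusp_scale_mx_unit X)) e mul1mx.
rewrite cusp_scale_mxE -scalemxAl -!scalemxAr scalerA mulVf ?s1_neq0 //.
by rewrite scale1r mulmxA.
Qed.

End Width.

Section WidthConjugation.
Variables (C : numClosedFieldType) (r : nat) (W Wh Wi S dS : 'M[C]_r).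
Hypotheses (WiWh : Wi *m Wh = 1%:M) (WhWh : Wh *m Wh = W).
Hypotheses (WhJ : Wh^t* = Wh) (WiJ : Wi^t* = Wi).
Let Sg := Wi *m S *m Wh.
Let dSg := Wi *m dS *m Wh.

Let WhWi : Wh *m Wi = 1%:M.
Proof. exact: mulmx1C WiWh. Qed.

Lemma conj_width_l : W *m Sg = Wh *m S *m Wh.
Proof. by rewrite /Sg !mulmxA -WhWh -(mulmxA Wh Wh) WhWi mulmx1. Qed.

Lemma conj_width_r : Sg^t* *m W = Wh *m S^t* *m Wh.
Proof.
by rewrite /Sg !adjmxM WhJ WiJ -WhWh -!mulmxA (mulmxA Wi) WiWh mul1mx.
Qed.

(** The factor W between the two conjugates removes the inner W^(-1/2) on both sides and leaves an
    outer W^(1/2) on each. *)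
Lemma conj_width_deriv :
  'i *: (Sg^t* *m W *m dSg) = Wh *m ('i *: (S^t* *m dS)) *m Wh.
Proof.
rewrite conj_width_r /dSg -!mulmxA (mulmxA Wh Wi) WhWi mul1mx.
by rewrite -scalemxAl -scalemxAr !mulmxA.
Qed.

Lemma conj_width_herm : ('i *: (S^t* *m dS))^t* = 'i *: (S^t* *m dS) ->
  ('i *: (Sg^t* *m W *m dSg))^t* = 'i *: (Sg^t* *m W *m dSg).
Proof. by move=> KJ; rewrite conj_width_deriv !adjmxM KJ WhJ mulmxA. Qed.

Lemma conj_width_isqrt (K : 'M[C]_r) : Wi *m (Wh *m K *m Wh) *m Wi = K.
Proof. by rewrite !mulmxA WiWh mul1mx -mulmxA WhWi mulmx1. Qed.

(** Applied with s = sqrt(q+1), n = 2N+1, e = (z^-1 - z)^-1 and p, p' the powers z^-(2N+1),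
    z^(2N+1). *)
Lemma conj_width_gram (s n e p p' : C) :
  s *: Wh *m (n *: 1%:M + 'i *: (S^t* *m dS) + e *: (p *: S - p' *: S^t*)) *m (s *: Wh) =
  (s * s) *: (n *: W + 'i *: (Sg^t* *m W *m dSg) +
              e *: (p *: (W *m Sg) - p' *: (Sg^t* *m W))).
Proof.
rewrite conj_width_deriv conj_width_l conj_width_r -!scalemxAl -scalemxAr scalerA.
congr (_ *: _); rewrite !mulmxDr !mulmxDl -[in LHS]scalemxAr mulmx1.
rewrite -[in LHS]scalemxAl WhWh; congr (_ + _).
rewrite -scalemxAr -scalemxAl; congr (_ *: _).
by rewrite mulmxBr mulmxBl -!scalemxAr -!scalemxAl.
Qed.

End WidthConjugation.

Section UnitCircle.
Variables (R : realType) (k : finFieldType) (Gamma : subgroup (PGL2 (laurent k))).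
Hypothesis stab_fin : forall v, finite_set (stab Gamma v).
Variables (d r : nat) (X : cusp_decomposition R Gamma d r).
Variable t : R.
Local Notation C := R[i].
Local Notation a := (sqrtq R k).
Local Notation z := (expi t : C).
Hypothesis Fu : Fmx X z \in unitmx.
Local Notation S := (Smx X z).
Local Notation dS := (Smx_deriv X t).

Lemma Smx_deriv_herm : ('i *: (S^t* *m dS))^t* = 'i *: (S^t* *m dS).
Proof.
exact: (adjS_dS_herm (sqrtq_neq0 R k) (sqrtqJ R k) (expi_neq0 t) (expiJ t)
  (core_matrix_herm stab_fin X) Fu).
Qed.

Lemma unit_circle_gram N : z^-1 - z != 0 ->
  ((z^-1 - z) *: (invmx (Fmx X z) *m core_ray_matrix X))^t* *m
    ((z^-1 - z) *: (invmx (Fmx X z) *m core_ray_matrix X)) +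
  \sum_(n < N) (z ^+ n.+1 *: 1%:M + z ^- n.+1 *: S)^t* *m
               (z ^+ n.+1 *: 1%:M + z ^- n.+1 *: S) =
  (2 * N + 1)%:R *: 1%:M + 'i *: (S^t* *m dS) +
    (z^-1 - z)^-1 *: (z ^- (2 * N + 1) *: S - z ^+ (2 * N + 1) *: S^t*).
Proof.
move=> delta0.
exact: (truncated_gram_formula (sqrtq_neq0 R k) (sqrtqJ R k) (expi_neq0 t) (expiJ t)
  (core_matrix_herm stab_fin X) Fu delta0 N).
Qed.

End UnitCircle.

Theorem theorem2p22 (R : realType) (k : finFieldType)
    (Gamma : subgroup (PGL2 (laurent k)))
    (hGamma : nonuniform_arithmetic_lattice Gamma R)
    (d r : nat) (hd : (1 <= d)%N) (X : cusp_decomposition R Gamma d r)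
    (N : nat) (hN : (1 <= N)%N)
    (theta : R) (htheta : 0 < theta < pi) (hThetaF : ~ Theta_F X theta) :
  let W := width_mx X in
  let Sg := Sigma X theta in
  let dSg := mxderive (Sigma X) theta in
  let S := fun t => Smx X (expi t) in
  [/\ mxderivable (Sigma X) theta /\ mxderivable S theta,
      truncated_gram X N (s_theta k theta) =
        (#|k|%:R + 1) *:
          ((2 * N + 1)%:R *: W + 'i *: (Sg^t* *m W *m dSg)
           + ('i / (2 * (sin theta)%:C)) *:
               (expi (- ((2 * N + 1)%:R * theta)) *: (W *m Sg)
                - expi ((2 * N + 1)%:R * theta) *: (Sg^t* *m W))),
      ('i *: (Sg^t* *m W *m dSg)) \is hermsymmx &
      width_mx_isqrt X *m ('i *: (Sg^t* *m W *m dSg)) *m width_mx_isqrt X =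
        'i *: ((S theta)^t* *m mxderive S theta)].
Proof.
have [[stab_fin _] _ _] := hGamma.
have Fu : Fmx X (expi theta) \in unitmx.
  by rewrite unitmxE unitfE; apply/eqP => F0; apply: hThetaF.
move=> W Sg dSg S.
pose Wh := width_mx_sqrt X; pose Wi := width_mx_isqrt X.
have SigmaE u : Fmx X (expi u) \in unitmx -> Sigma X u = Wi *m S u *m Wh.
  by move=> Fu'; rewrite /Sigma (SautE stab_fin Fu') cusp_scale_conj.
have dS := is_mxderive_Smx Fu.
(* The formula [SigmaE] is available only where F is invertible; this holds on a neighborhood of
   [theta], which is enough for the derivative. *)
have dSigma : is_mxderive theta (Sigma X) (Wi *m Smx_deriv X theta *m Wh).
  apply: near_is_mxderive (is_mxderive_mulmx Wi Wh dS).
  have := near_unitmx (is_mxderive_mxderivable (is_mxderive_Fmx X theta)) Fu.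
  by apply: filterS => u /SigmaE ->.
have SgE : Sg = Wi *m S theta *m Wh by exact: SigmaE.
have dSgE : dSg = Wi *m Smx_deriv X theta *m Wh by exact: is_mxderive_mxderive.
have WiWh : Wi *m Wh = 1%:M by exact: width_mx_isqrtK.
have WhWh : Wh *m Wh = W by exact: mul_width_mx_sqrt.
have WhJ : Wh^t* = Wh by exact: adj_width_mx_sqrt.
have WiJ : Wi^t* = Wi by exact: adj_width_mx_isqrt.
have KJ := Smx_deriv_herm stab_fin Fu.
have dSE : mxderive S theta = Smx_deriv X theta by exact: is_mxderive_mxderive.
split; rewrite ?SgE ?dSgE ?dSE.
- by split; [exact: is_mxderive_mxderivable dSigma | exact: is_mxderive_mxderivable dS].
- have sin0 : (sin theta)%:C != 0 :> R[i].
    by rewrite fmorph_eq0 gt_eqF // sin_gt0_pi.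
  have delta0 : (expi theta)^-1 - expi theta != 0 :> R[i].
    by rewrite expiV_sub oppr_eq0 !mulf_neq0 ?pnatr_eq0 ?neq0Ci.
  (* Since z^-1 - z = -2i sin(theta), inverting produces the prefactor of the oscillating terms. *)
  have deltaV : ((expi theta)^-1 - expi theta)^-1 = 'i / (2 * (sin theta)%:C) :> R[i].
    apply: (mulfI delta0); rewrite divff // expiV_sub.
    transitivity (- ('i * 'i) : R[i]); first by rewrite -expr2 sqrCi opprK.
    by field.
  rewrite (truncated_gramE stab_fin Fu) (unit_circle_gram stab_fin Fu _ delta0).
  rewrite cusp_scale_mxE expiN expiMn -deltaV -s1_sqr.
  exact: conj_width_gram WiWh WhWh WhJ WiJ _ _ _ _ _.
- by rewrite qualifE /= expr0 scale1r; apply/eqP/esym/conj_width_herm.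
- by rewrite (conj_width_deriv _ _ WiWh WhWh WhJ WiJ) (conj_width_isqrt WiWh).
Qed.
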